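(* For every continuous proper homogeneous gauge $N$ on the Carnot group $\mathbb G$, $$L^2(S_N,\sigma_N)=\widehat{\bigoplus_{m=0}^{\infty}}\mathscr W_m$$ (orthogonal Hilbert direct sum). More precisely, for every $m\ge 0$, $\mathscr V_m=\mathscr V_{m-1}\oplus\mathscr W_m$ as an orthogonal direct sum, and $\dim\mathscr W_m=\dim\mathscr V_m-\dim\mathscr V_{m-1}$. If $I(S_N)$ is the ideal of coordinate polynomials vanishing on $S_N$, then $$\dim\mathscr V_m=\dim\mathscr A_m-\dim\bigl(I(S_N)\cap\mathscr A_m\bigr).$$
   Context: $\mathbb G$ is a connected, simply connected Carnot group with stratified Lie algebra $\mathfrak g=V_1\oplus\cdots\oplus V_s$, $[V_1,V_j]=V_{j+1}$ for $1\le j<s$, $[V_1,V_s]=\{0\}$; $d_j=\dim V_j$ and $Q=\sum_j jd_j$. Exponential coordinates $x=(x_{j,k})$ ($1\le j\le s$, $1\le k\le d_j$) adapted to the stratification are fixed, with dilations $\delta_r(x_{j,k})=(r^jx_{j,k})$, $r>0$. With complex coefficients, $P_m(\mathbb G)$ is the space of coordinate polynomials $p$ with $p\circ\delta_r=r^mp$ for all $r>0$, and $\mathscr A_m=\bigoplus_{j=0}^mP_j(\mathbb G)$ ($\{0\}$ for $m<0$). A continuous proper homogeneous gauge is a continuous proper function $N:\mathbb G\to[0,\infty)$ with $N(e)=0$, $N(x)>0$ for $x\ne e$, $N(\delta_rx)=rN(x)$. $S_N=\{N=1\}$, and $\sigma_N$ is the finite Radon measure on $S_N$ with $\int_{\mathbb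 G}f\,dx=\int_0^\infty\int_{S_N}f(\delta_r\omega)\,d\sigma_N(\omega)\,r^{Q-1}dr$ for $f\in C_c(\mathbb G\setminus\{e\})$, $dx$ being Haar measure. $\mathscr V_m=\{p|_{S_N}:p\in\mathscr A_m\}$, $\mathscr V_{-1}=\{0\}$, $\mathscr W_m=\mathscr V_m\cap\mathscr V_{m-1}^\perp$, the orthogonal complement being in (complex) $L^2(S_N,\sigma_N)$; trace spaces are regarded as subspaces of $L^2(S_N,\sigma_N)$. *)

(* Defs.v *)
From HB Require Import structures.
From mathcomp Require Import all_boot all_order all_algebra.
From mathcomp Require Import generic_quotient ring_quotient.
From mathcomp Require Import all_classical all_reals all_analysis.
From mathcomp.real_closed Require Import complex.
From mathcomp.multinomials Require Import -(notations) mpoly.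

Set Implicit Arguments.
Unset Strict Implicit.
Unset Printing Implicit Defensive.

Import Order.TTheory GRing.Theory Num.Theory.
Import numFieldNormedType.Exports.

Local Open Scope classical_set_scope.
Local Open Scope quotient_scope.
Local Open Scope ring_scope.

(* Coordinates x_{j,k} are listed by a single index i : 'I_n, and the weight
   w i = j records the layer; the coordinate vectors of weight j are the part of
   the adapted basis that spans V_j. *)
Definition layer (R : realType) (n : nat) (w : 'I_n -> nat) (j : nat) :
    {vspace 'rV[R]_n} :=
  <<[seq delta_mx ord0 i | i <- enum 'I_n & w i == j]>>%VS.

(* [U, W], the span of all brackets; by bilinearity bases suffice. *)
Definition lie_prodv (R : realType) (n : nat)
    (br : 'rV[R]_n -> 'rV[R]_n -> 'rV[R]_n) (U W : {vspace 'rV[R]_n}) :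
    {vspace 'rV[R]_n} :=
  <<[seq br u v | u <- vbasis U, v <- vbasis W]>>%VS.

(* The stratified Lie algebra g, written in an adapted basis. The connected and
   simply connected group G is g itself (exp is a global diffeomorphism), with
   the Baker-Campbell-Hausdorff product [gop] below. *)
Record carnot (R : realType) := Carnot {
  gdim : nat;
  gstep : nat;
  weight : 'I_gdim -> nat;
  bracket : 'rV[R]_gdim -> 'rV[R]_gdim -> 'rV[R]_gdim;
  gstep_gt0 : (0 < gstep)%N;
  weight_bounds : forall i, (0 < weight i <= gstep)%N;
  bracket_linl : forall a x y z,
    bracket (a *: x + y) z = a *: bracket x z + bracket y z;
  bracket_linr : forall a x y z,
    bracket z (a *: x + y) = a *: bracket z x + bracket z y;
  bracketxx : forall x, bracket x x = 0;
  bracket_jacobi : forall x y z,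
    bracket x (bracket y z) + bracket y (bracket z x)
      + bracket z (bracket x y) = 0;
  bracket_layer : forall j, (0 < j < gstep)%N ->
    lie_prodv bracket (layer R weight 1) (layer R weight j)
      = layer R weight j.+1;
  bracket_top :
    lie_prodv bracket (layer R weight 1) (layer R weight gstep) = 0%VS
}.

Section CarnotGroup.
Context (R : realType) (G : carnot R).
Implicit Types x y : 'rV[R]_(gdim G).

(* [a_1, [a_2, ... [a_(l-1), a_l] ... ]] *)
Fixpoint lie_word (s : seq 'rV[R]_(gdim G)) : 'rV[R]_(gdim G) :=
  match s with
  | [::] => 0
  | [:: a] => a
  | a :: s' => bracket a (lie_word s')
  end.

(* Dynkin's form of the Baker-Campbell-Hausdorff series log (exp x exp y):
   the sum over k >= 1 and pairs (r_i, s_i) with r_i + s_i > 0 of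
     (-1)^(k-1)/k * [x^{r_1} y^{s_1} ... x^{r_k} y^{s_k}]
       / ((sum_i (r_i + s_i)) * prod_i r_i! s_i!).
   Brackets of more than gstep letters vanish, so bounding k, r_i and s_i by
   gstep discards only zero terms. The index k below is k - 1. *)
Definition gop x y : 'rV[R]_(gdim G) :=
  let I := ('I_(gstep G).+1 * 'I_(gstep G).+1)%type in
  \sum_(k < gstep G)
   \sum_(e : k.+1.-tuple I | all (fun p : I => 0 < p.1 + p.2)%N e)
    (((-1) ^+ k / k.+1%:R)
       / ((\sum_(p <- e) (p.1 + p.2)) * \prod_(p <- e) (p.1`! * p.2`!))%N%:R)
    *: lie_word (flatten [seq nseq p.1 x ++ nseq p.2 y | p : I <- e]).

Definition dil (r : R) x : 'rV[R]_(gdim G) :=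
  \row_i (r ^+ weight i * x ord0 i).

Definition layer_dim (j : nat) : nat := \dim (layer R (@weight R G) j).

Definition hom_dim : nat := (\sum_(1 <= j < (gstep G).+1) j * layer_dim j)%N.

Definition borelG := g_sigma_algebraType (@open 'rV[R]_(gdim G)).

(* mu is then Radon, every Borel measure on R^n finite on compacts being so. *)
Definition is_haar (mu : {measure set borelG -> \bar R}) :=
  [/\ forall (a : 'rV[R]_(gdim G)) (A : set borelG), measurable A ->
        mu [set gop a x | x in A] = mu A,
      forall K : set 'rV[R]_(gdim G), compact K -> (mu K < +oo)%E &
      forall U : set 'rV[R]_(gdim G), open U -> U !=set0 -> (0 < mu U)%E].

Definition is_gauge (N : 'rV[R]_(gdim G) -> R) :=
  [/\ continuous N,
      forall K : set R, compact K -> compact (N @^-1` K),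
      N 0 = 0 /\ (forall x, x != 0 -> 0 < N x) &
      forall r x, 0 < r -> N (dil r x) = r * N x].

Definition sphere (N : 'rV[R]_(gdim G) -> R) : set 'rV[R]_(gdim G) :=
  [set x | N x = 1].

(* f \in C_c(G \ {e}); the test functions may be taken real-valued. *)
Definition Cc_punctured (f : 'rV[R]_(gdim G) -> R) :=
  [/\ continuous f,
      compact (closure [set x | f x != 0]) &
      ~ closure [set x | f x != 0] 0].

(* The measure sigma_N on S_N is represented by the Borel measure on G carried
   by S_N; finite Borel measures on R^n are automatically Radon. For
   gdim G > 0, hom_dim is positive and hom_dim.-1 is Q - 1. *)
Definition is_sphere_measure (mu : {measure set borelG -> \bar R})
    (N : 'rV[R]_(gdim G) -> R) (sigma : {finite_measure set borelG -> \bar R}) :=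
  sigma (~` sphere N) = 0%E /\
  forall f, Cc_punctured f ->
    (\int[mu]_x (f x)%:E =
     \int[@lebesgue_measure R]_(r in `]0%R, +oo[)
       ((\int[sigma]_(omega in sphere N) (f (dil r omega))%:E)
          * (r ^+ hom_dim.-1)%:E))%E.

End CarnotGroup.

Section Dimension.
Context (K : fieldType) (V : lmodType K).

Definition has_dim (U : set V) (d : nat) :=
  exists b : 'I_d -> V,
    (forall c : 'I_d -> K, \sum_i c i *: b i = 0 -> forall i, c i = 0) /\
    U = [set \sum_i c i *: b i | c in [set: 'I_d -> K]].

End Dimension.

Section ComplexL2.
Context d (T : measurableType d) (R : realType) (mu : {measure set T -> \bar R}).

Definition L2pred : {pred T -> R[i]} := fun f =>
  ((@complex.Re R \o f) \in Lfun mu 2%:E)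
    && ((@complex.Im R \o f) \in Lfun mu 2%:E).

Let le12 : (1 <= 2%:E :> \bar R)%E. Proof. by rewrite lee_fin ler1n. Qed.

Lemma L2pred_submod : submod_closed L2pred.
Proof.
have [L0 L] := Lfun_submod_closed mu le12.
have LZ a f : f \in Lfun mu 2%:E -> a *: f \in Lfun mu 2%:E.
  by move=> fL; rewrite -[_ *: _]addr0; exact: L.
have LD f g : f \in Lfun mu 2%:E -> g \in Lfun mu 2%:E ->
    f + g \in Lfun mu 2%:E.
  by move=> fL gL; rewrite -[f]scale1r; exact: L.
split; first by apply/andP; split; exact: L0.
move=> [a b] f g /andP[fr fi] /andP[gr gi]; apply/andP; split.
- have -> : @complex.Re R \o ((a +i* b)%C *: f + g) =
     a *: (@complex.Re R \o f) + (- b) *: (@complex.Im R \o f)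
       + (@complex.Re R \o g).
    apply/funext => x; rewrite /= !fctE /=.
    by case: (f x) (g x) => [? ?] [? ?] /=; rewrite [in RHS]/GRing.scale/= mulNr.
  by rewrite !(LD, LZ).
- have -> : @complex.Im R \o ((a +i* b)%C *: f + g) =
     a *: (@complex.Im R \o f) + b *: (@complex.Re R \o f)
       + (@complex.Im R \o g).
    apply/funext => x; rewrite /= !fctE /=.
    by case: (f x) (g x) => [? ?] [? ?].
  by rewrite !(LD, LZ).
Qed.

HB.instance Definition _ := GRing.isSubmodClosed.Build R[i] (T -> R[i]) L2pred
  L2pred_submod.

Record L2fun := L2Fun { L2fun_val :> T -> R[i]; _ : L2fun_val \in L2pred }.

HB.instance Definition _ := [isSub for L2fun_val].
HB.instance Definition _ := [Choice of L2fun by <:].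
HB.instance Definition _ := [SubChoice_isSubLmodule of L2fun by <:].

Definition L2null : {pred L2fun} := fun f => `[< {ae mu, forall x, f x = 0} >].

Lemma L2null_zmod : zmod_closed L2null.
Proof.
split; first by apply/asboolP; exact: aeW.
move=> f g /asboolP f0 /asboolP g0; apply/asboolP.
by apply: filterS2 f0 g0 => x fx gx; rewrite /= !fctE fx gx subrr.
Qed.

HB.instance Definition _ := GRing.isZmodClosed.Build L2fun L2null L2null_zmod.

Definition L2 : Type := Quotient.quot L2null.

HB.instance Definition _ := GRing.Zmodule.on L2.
HB.instance Definition _ := EqQuotient.on L2.

Definition L2scale (a : R[i]) (u : L2) : L2 := \pi_(L2) (a *: repr u).

Lemma pi_L2scale (a : R[i]) (f : L2fun) :
  L2scale a (\pi_(L2) f) = \pi_(L2) (a *: f).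
Proof.
apply/eqmodP; rewrite /= Quotient.equivE.
have /eqmodP := reprK (\pi_(L2) f : L2).
rewrite /= Quotient.equivE => /asboolP f0; apply/asboolP.
apply: filterS f0 => x; rewrite -scalerBr /= !fctE => ->.
by rewrite scaler0.
Qed.

Fact L2scaleA a b (u : L2) : L2scale a (L2scale b u) = L2scale (a * b) u.
Proof. by rewrite {2}/L2scale pi_L2scale scalerA. Qed.

Fact L2scale1 : left_id 1 L2scale.
Proof. by move=> u; rewrite /L2scale scale1r reprK. Qed.

Lemma pi_L2D (f g : L2fun) : \pi_(L2) (f + g) = \pi_(L2) f + \pi_(L2) g.
Proof. exact: Quotient.pi_add. Qed.

Fact L2scaleDr : right_distributive L2scale +%R.
Proof.
move=> a u v; rewrite -[u]reprK -[v]reprK -pi_L2D.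
by rewrite !pi_L2scale scalerDr pi_L2D.
Qed.

Fact L2scaleDl u : {morph L2scale^~ u : a b / a + b}.
Proof. by move=> a b; rewrite /L2scale scalerDl pi_L2D. Qed.

HB.instance Definition _ := GRing.Zmodule_isLmodule.Build R[i] L2
  L2scaleA L2scale1 L2scaleDr L2scaleDl.

Definition L2rep (u : L2) : T -> R[i] := (repr u : L2fun).
Coercion L2rep : L2 >-> Funclass.

Definition L2ip (u v : L2) : R[i] :=
  Complex (\int[mu]_x complex.Re (u x * conjc (v x)))
          (\int[mu]_x complex.Im (u x * conjc (v x))).

Definition L2norm (u : L2) : R := Num.sqrt (complex.Re (L2ip u u)).

Definition L2cvg (u_ : nat -> L2) (u : L2) :=
  (fun n => L2norm (u_ n - u)) @ \oo --> (0 : R).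

Definition L2subspace (U : set L2) :=
  U 0 /\ forall a u v, U u -> U v -> U (a *: u + v).

Definition L2closed (U : set L2) :=
  forall (u_ : nat -> L2) u, (forall n, U (u_ n)) -> L2cvg u_ u -> U u.

Definition L2orth (U W : set L2) := forall u w, U u -> W w -> L2ip u w = 0.

Definition L2compl (U : set L2) : set L2 :=
  [set w | forall u, U u -> L2ip w u = 0].

Definition orth_direct_sum (U1 U2 U : set L2) :=
  [/\ L2subspace U1 /\ L2subspace U2, L2orth U1 U2, U1 `&` U2 = [set 0] &
      U = [set u | exists u1 u2, [/\ U1 u1, U2 u2 & u = u1 + u2]]].

Definition hilbert_direct_sum (W : nat -> set L2) :=
  [/\ forall m, L2subspace (W m) /\ L2closed (W m),
      forall m l, m != l -> L2orth (W m) (W l) &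
      forall u, exists! w : nat -> L2,
        (forall m, W m (w m)) /\ L2cvg (fun n => \sum_(m < n) w m) u].

End ComplexL2.

Section Traces.
Context (R : realType) (G : carnot R).

Local Notation cpoly := (mpoly (gdim G) R[i]).

Definition peval (p : cpoly) (x : 'rV[R]_(gdim G)) : R[i] :=
  meval (fun i => (x ord0 i)%:C%C) p.

Definition polyP (m : nat) : set cpoly :=
  [set p | forall r x, 0 < r -> peval p (dil r x) = (r ^+ m)%:C%C * peval p x].

Definition polyA (m : int) : set cpoly :=
  match m with
  | Posz k => [set p | exists q : nat -> cpoly,
                 (forall j, polyP j (q j)) /\ p = \sum_(j < k.+1) q j]
  | Negz _ => [set 0]
  end.

Variable (N : 'rV[R]_(gdim G) -> R).

Definition vanishing_ideal : set cpoly :=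
  [set p | forall x, sphere N x -> peval p x = 0].

Variable (sigma : {finite_measure set (borelG G) -> \bar R}).

(* u x = p x is required only on S_N, which carries sigma: u is the class of the
   restriction of p to S_N. *)
Definition traceV (m : int) : set (L2 sigma) :=
  [set u | exists2 p, polyA m p &
     {ae sigma, forall x, sphere N x -> u x = peval p x}].

Definition traceW (m : int) : set (L2 sigma) :=
  traceV m `&` L2compl (traceV (m - 1)).

End Traces.

Arguments polyP {R} G m.
Arguments polyA {R} G m.
Arguments vanishing_ideal {R G} N.
Arguments traceV {R G} N sigma m.
Arguments traceW {R G} N sigma m.

(* Main.v *)
Require Import Defs.
From mathcomp Require Import all_boot all_order all_algebra finmap.
From mathcomp Require Import all_classical all_reals all_analysis.
From mathcomp.real_closed Require Import complex.
From mathcomp.multinomials Require Import -(notations) mpoly.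
From mathcomp Require Import generic_quotient ring_quotient.
From mathcomp Require Import measurable_realfun.
From mathcomp Require Import ring lra.

Set Implicit Arguments.
Unset Strict Implicit.
Unset Printing Implicit Defensive.

Import Order.TTheory GRing.Theory Num.Theory.
Import numFieldNormedType.Exports.

Local Open Scope classical_set_scope.
Local Open Scope ring_scope.

(** The spaces V_m increase, are finite dimensional, and start from V_(-1) = 0.
    For such a chain in any complex inner product space, W_m is the orthogonal
    complement of V_(m-1) in V_m, so the projection of u onto V_n is the sum of
    its projections onto the W_m with m <= n. By best approximation these partial
    sums tend to u as soon as the union of the chain is dense; the coefficients
    are unique because the W_m are mutually orthogonal ([orthogonal_expansion]).
    What remains is about polynomials and the measure sigma, and consists of
    three facts.

    Finite dimension. All weights are positive, and comparing coefficients in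
    p (dil 2 x) = 2 ^ j * p x shows that a homogeneous polynomial of degree j only
    contains monomials of weighted degree j ([homogeneous_wdeg]); there are
    finitely many of them.

    Density. The real polynomials form an algebra of functions bounded on the
    compact sphere. The iterates of x |-> x * (3 - x ^ 2) / 2 converge to the sign
    on [-1, 1], hence the indicator of {g > 0}, for g polynomial, is a bounded
    pointwise limit of polynomials on the sphere, and so an L^2 limit. The
    sets whose indicator is an L^2 limit of polynomials form a sigma-algebra, and
    the sets {g > 0} generate the Borel sets. So all indicators, then simple
    functions, then all square integrable functions are L^2 limits of polynomials
    ([approximable_sqint]).

    Faithfulness. A polynomial p whose class in L^2 is 0 vanishes at every point
    of the sphere ([sphere_measure_full_support]). If p = q_0 + ... + q_k with q_j
    homogeneous of degree j, then F x = sum_j N x ^ (k - j) * q_j x is continuous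
    and F (dil r omega) = r ^ k * p omega for omega in the sphere. A bump in N x
    times |F x|^2 is therefore a test function for the polar formula whose
    spherical integrals all vanish; its Haar integral is 0, and since Haar measure
    charges open sets the function is 0. Hence the kernel of restriction to the
    sphere, on A_m, is the intersection of A_m with the vanishing ideal, and the
    last dimension formula is the rank-nullity theorem. *)

(** * Finite-dimensional subspaces *)

Section FiniteDimension.
Context (K : fieldType) (V : lmodType K).
Implicit Types U W : set V.

Definition is_subspace U := U 0 /\ forall a u v, U u -> U v -> U (a *: u + v).

(** Adding one vector to a subspace; [has_dimS] and [has_dimS_inv] make this the
    induction step of every argument about dimensions below. *)
Definition adjoin U u : set V := [set x | exists a v, U v /\ x = a *: u + v].

Lemma subspaceD U u v : is_subspace U -> U u -> U v -> U (u + v).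
Proof. by move=> [_ L] Uu Uv; rewrite -[u]scale1r; exact: L. Qed.

Lemma subspaceZ U a u : is_subspace U -> U u -> U (a *: u).
Proof. by move=> [U0 L] Uu; rewrite -[_ *: _]addr0; exact: L. Qed.

Lemma subspaceB U u v : is_subspace U -> U u -> U v -> U (u - v).
Proof. by move=> UU Uu Uv; rewrite addrC -scaleN1r; apply: UU.2. Qed.

Lemma subspace_sum U n (v : 'I_n -> V) :
  is_subspace U -> (forall i, U (v i)) -> U (\sum_i v i).
Proof.
move=> UU Uv; apply: big_ind => //; [exact: UU.1|].
by move=> x y; exact: subspaceD.
Qed.

Lemma subspace_setI U W : is_subspace U -> is_subspace W -> is_subspace (U `&` W).
Proof.
by move=> [U0 UL] [W0 WL]; split=> // a u v [Uu Wu] [Uv Wv]; split;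
  [exact: UL|exact: WL].
Qed.

Lemma subspace_set0 : is_subspace [set 0 : V].
Proof. by split=> // a u v -> ->; rewrite scaler0 addr0. Qed.

Lemma has_dim_subspace U d : has_dim U d -> is_subspace U.
Proof.
move=> [b [_ ->]]; split.
  by exists (fun=> 0) => //; apply: big1 => i _; rewrite scale0r.
move=> a _ _ [c _ <-] [e _ <-]; exists (fun i => a * c i + e i) => //.
by rewrite scaler_sumr -big_split; apply: eq_bigr => i _; rewrite scalerDl scalerA.
Qed.

Lemma has_dim0 : has_dim [set 0 : V] 0.
Proof.
exists (fun=> 0); split; first by move=> c _ [].
apply/seteqP; split=> [x ->|x [c _ <-]]; last by rewrite big_ord0.
by exists (fun=> 0) => //; rewrite big_ord0.
Qed.

Lemma has_dim0_eq U : has_dim U 0 -> U = [set 0].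
Proof.
move=> [b [_ ->]]; apply/seteqP; split=> [x [c _ <-]|x ->]; first by rewrite big_ord0.
by exists (fun=> 0) => //; rewrite big_ord0.
Qed.

Lemma has_dimS U d u : has_dim U d -> ~ U u -> has_dim (adjoin U u) d.+1.
Proof.
move=> Ud NUu; have US := has_dim_subspace Ud.
case: Ud US NUu => b [bfree UE] US NUu.
pose b' (i : 'I_d.+1) := if unlift ord0 i is Some j then b j else u.
have sumE c : \sum_i c i *: b' i =
    c ord0 *: u + \sum_i c (lift ord0 i) *: b i.
  rewrite big_ord_recl {1}/b' unlift_none; congr (_ + _).
  by apply: eq_bigr => i _; rewrite /b' liftK.
exists b'; split.
  move=> c; rewrite sumE => c0.
  have c00 : c ord0 = 0.
    apply: contra_notP NUu => /eqP cn0.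
    have -> : u = - (c ord0)^-1 *: \sum_i c (lift ord0 i) *: b i.
      move/eqP: c0; rewrite addr_eq0 => /eqP e.
      rewrite scaleNr -scalerN -[X in _ *: X](opprK) opprK -e.
      by rewrite scalerA mulVf// scale1r.
    by apply: subspaceZ => //; rewrite UE; exists (fun i => c (lift ord0 i)).
  move: c0; rewrite c00 scale0r add0r => /bfree cl i.
  by case: (unliftP ord0 i) => [j ->|->].
apply/seteqP; split.
  move=> x [a [v []]]; rewrite UE => -[c _ <-] ->.
  exists (fun i => if unlift ord0 i is Some j then c j else a) => //.
  rewrite sumE unlift_none; congr (_ + _).
  by apply: eq_bigr => i _; rewrite liftK.
move=> x [c _ <-]; rewrite sumE; exists (c ord0), (\sum_i c (lift ord0 i) *: b i).
by split=> //; rewrite UE; exists (fun i => c (lift ord0 i)).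
Qed.

Lemma has_dimS_inv U d : has_dim U d.+1 ->
  exists U' u, [/\ has_dim U' d, ~ U' u & U = adjoin U' u].
Proof.
move=> [b [bfree UE]].
exists [set \sum_i c i *: b (lift ord0 i) | c in [set: 'I_d -> K]], (b ord0); split.
- exists (fun i => b (lift ord0 i)); split=> // c c0 i.
  pose c' (i : 'I_d.+1) := if unlift ord0 i is Some j then c j else 0.
  have /bfree/(_ (lift ord0 i)) : \sum_i c' i *: b i = 0.
    rewrite big_ord_recl /c' unlift_none scale0r add0r -[RHS]c0.
    by apply: eq_bigr => j _; rewrite liftK.
  by rewrite /c' liftK.
- move=> [c _ cE].
  pose c' (i : 'I_d.+1) := if unlift ord0 i is Some j then c j else -1.
  have /bfree/(_ ord0)/eqP : \sum_i c' i *: b i = 0.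
    rewrite big_ord_recl /c' unlift_none scaleN1r -cE addrC.
    apply/eqP; rewrite subr_eq0; apply/eqP.
    by apply: eq_bigr => j _; rewrite liftK.
  by rewrite /c' unlift_none oppr_eq0 oner_eq0.
- rewrite UE; apply/seteqP; split=> x.
    move=> [c _ <-]; rewrite big_ord_recl.
    by exists (c ord0), (\sum_(i < d) c (lift ord0 i) *: b (lift ord0 i)).
  move=> [a [v [[c _ <-] ->]]].
  exists (fun i => if unlift ord0 i is Some j then c j else a) => //.
  rewrite big_ord_recl unlift_none; congr (_ + _).
  by apply: eq_bigr => j _; rewrite liftK.
Qed.

Lemma adjoin_id U u : is_subspace U -> U u -> adjoin U u = U.
Proof.
move=> US Uu; apply/seteqP; split=> [_ [a [v [Uv ->]]]|x Ux]; first exact: US.2.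
by exists 0, x; rewrite scale0r add0r.
Qed.

Lemma sub_adjoin U u : U `<=` adjoin U u.
Proof. by move=> x Ux; exists 0, x; rewrite scale0r add0r. Qed.

Lemma adjoin_mem U u : is_subspace U -> adjoin U u u.
Proof. by move=> [U0 _]; exists 1, 0; rewrite scale1r addr0. Qed.

Lemma adjoin_sub U W u : is_subspace W -> U `<=` W -> W u -> adjoin U u `<=` W.
Proof. by move=> WS UW Wu _ [a [v [Uv ->]]]; apply: WS.2 => //; exact: UW. Qed.

(** Write U = U' + K u. Either W lies in U', or some w in W has a nonzero component
    along u, and then W is W `&` U' with w adjoined. *)
Lemma has_dim_sub U W d : has_dim U d -> is_subspace W -> W `<=` U ->
  exists e, has_dim W e.
Proof.
elim: d U W => [|d IH] U W Ud WS WU.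
  exists 0%N; move: WU; rewrite (has_dim0_eq Ud) => WU.
  suff -> : W = [set 0] by exact: has_dim0.
  by apply/seteqP; split => // _ ->; case: WS.
have [U' [u [U'd NU'u UE]]] := has_dimS_inv Ud.
have U'S := has_dim_subspace U'd.
have [e We] := IH U' (W `&` U') U'd (subspace_setI WS U'S) (@subIsetr _ _ _).
have [WU'|/existsNP[w /not_implyP[Ww NU'w]]] := pselect (W `<=` U').
  by exists e; rewrite -(setIidl WU').
exists e.+1; suff -> : W = adjoin (W `&` U') w by apply: has_dimS => // -[].
apply/seteqP; split; last by apply: adjoin_sub => // x [].
have := WU w Ww; rewrite UE => -[a [v [U'v wE]]] x Wx.
have an0 : a != 0.
  by apply/eqP => a0; apply: NU'w; rewrite wE a0 scale0r add0r.
have := WU x Wx; rewrite UE => -[b [v' [U'v' xE]]].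
exists (b / a), (x - (b / a) *: w); split; last by rewrite addrC subrK.
split; first by apply: subspaceB => //; exact: subspaceZ.
rewrite xE wE scalerDr scalerA divfK// opprD addrACA subrr add0r.
by apply: subspaceB => //; exact: subspaceZ.
Qed.

Lemma has_dim_span n (b : 'I_n -> V) :
  exists d, has_dim [set \sum_i c i *: b i | c in [set: 'I_n -> K]] d.
Proof.
elim: n b => [|n IH] b.
  by exists 0%N, b; split=> // c _ [].
have [d Ud] := IH (fun i => b (lift ord0 i)).
set U := (X in has_dim X d) in Ud; have US := has_dim_subspace Ud.
suff -> : [set \sum_i c i *: b i | c in [set: 'I_n.+1 -> K]] = adjoin U (b ord0).
  have [Ub|NUb] := pselect (U (b ord0)); first by exists d; rewrite adjoin_id.
  by exists d.+1; exact: has_dimS.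
apply/seteqP; split=> x.
  move=> [c _ <-]; rewrite big_ord_recl.
  exists (c ord0), (\sum_(i < n) c (lift ord0 i) *: b (lift ord0 i)); split=> //.
  by exists (fun i => c (lift ord0 i)).
move=> [a [v [[c _ <-] ->]]].
exists (fun i => if unlift ord0 i is Some j then c j else a) => //.
rewrite big_ord_recl unlift_none; congr (_ + _).
by apply: eq_bigr => j _; rewrite liftK.
Qed.

Definition sum_set U W : set V :=
  [set x | exists u w, [/\ U u, W w & x = u + w]].

Lemma has_dim_direct_sum U W d e : has_dim U d -> has_dim W e ->
  U `&` W = [set 0] -> has_dim (sum_set U W) (d + e).
Proof.
move=> Ud; have US := has_dim_subspace Ud.
elim: e W => [|e IH] W We UW.
  rewrite addn0 (has_dim0_eq We).
  suff -> : sum_set U [set 0] = U by [].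
  apply/seteqP; split=> [_ [u [w [Uu -> ->]]]|x Ux]; first by rewrite addr0.
  by exists x, 0; rewrite addr0.
have WS := has_dim_subspace We.
have [W' [w [W'e NW'w WE]]] := has_dimS_inv We.
have W'S := has_dim_subspace W'e.
have W'W : W' `<=` W by rewrite WE; exact: sub_adjoin.
have Ww : W w by rewrite WE; exact: adjoin_mem.
have UW' : U `&` W' = [set 0].
  apply/seteqP; split=> [x [Ux /W'W Wx]|x ->]; first by rewrite -UW.
  by split; [case: US|case: W'S].
rewrite addnS; suff -> : sum_set U W = adjoin (sum_set U W') w.
  apply: has_dimS; first exact: IH.
  move=> [u [w' [Uu W'w' wE]]]; apply: NW'w.
  have : (U `&` W) u.
    split=> //; rewrite -(addrK w' u) -wE; by apply: subspaceB => //; exact: W'W.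
  by rewrite UW wE => ->; rewrite add0r.
apply/seteqP; split=> x.
  move=> [u [v [Uu]]]; rewrite WE => -[a [w' [W'w' ->]]] ->.
  by exists a, (u + w'); split; [exists u, w'|rewrite addrCA].
move=> [a [v [[u [w' [Uu W'w' ->]]] ->]]]; exists u, (a *: w + w'); split=> //.
  by rewrite WE; exists a, w'.
by rewrite addrCA.
Qed.

End FiniteDimension.

Section RankNullity.
Context (K : fieldType) (V V' : lmodType K) (f : V -> V').
Hypothesis flin : forall a u v, f (a *: u + v) = a *: f u + f v.

(** Induction on the dimension of U = U' + K u: if f u is already the image of some
    v in U', then u - v is a new kernel vector and the image is unchanged; otherwise
    the image grows and the kernel is unchanged. *)
Lemma rank_nullity (U : set V) d : has_dim U d ->
  exists k r, [/\ has_dim (U `&` [set u | f u = 0]) k, has_dim (f @` U) r & d = (k + r)%N].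
Proof.
have f0 : f 0 = 0.
  by have := flin (-1) 0 0; rewrite scaler0 addr0 scaleN1r addNr.
have fB u v : f (u - v) = f u - f v by rewrite addrC -scaleN1r flin scaleN1r addrC.
have kerS : is_subspace [set u | f u = 0].
  by split=> //= a u v fu fv; rewrite flin fu fv scaler0 addr0.
elim: d U => [|d IH] U Ud.
  exists 0%N, 0%N; rewrite (has_dim0_eq Ud) image_set1 f0; split=> //.
    suff -> : [set 0] `&` [set u | f u = 0] = [set 0] by exact: has_dim0.
    by apply/seteqP; split=> [x []|x ->].
  exact: has_dim0.
have [U' [u [U'd NU'u UE]]] := has_dimS_inv Ud.
have U'S := has_dim_subspace U'd.
have [k [r [kd rd dE]]] := IH _ U'd.
have imE : f @` U = adjoin (f @` U') (f u).
  rewrite UE; apply/seteqP; split=> x.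
    by move=> [_ [a [v [U'v ->]]] <-]; exists a, (f v); split=> //; exists v.
  by move=> [a [x0 [[v U'v <-] ->]]]; exists (a *: u + v) => //; exists a, v.
have rS := has_dim_subspace rd.
have [[v U'v fvu]|Nfu] := pselect ((f @` U') (f u)).
  exists k.+1, r; rewrite addSn -dE imE (adjoin_id rS)//; last by exists v.
  split=> //.
  have fuv : f (u - v) = 0 by rewrite fB fvu subrr.
  have NU'uv : ~ U' (u - v).
    by move=> h; apply: NU'u; rewrite -(subrK v u); exact: subspaceD.
  suff -> : U `&` [set u | f u = 0] = adjoin (U' `&` [set u | f u = 0]) (u - v).
    by apply: has_dimS => // -[].
  apply/seteqP; split=> x.
    rewrite UE => -[[a [w [U'w ->]]] /=]; rewrite flin => fx.
    exists a, (a *: v + w); split; last by rewrite scalerBr addrA subrK.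
    by split; [exact: U'S.2|rewrite /= flin fvu].
  move=> [a [w [[U'w fw] ->]]]; split; last first.
    by rewrite /= flin fuv scaler0 add0r.
  rewrite UE; exists a, (w - a *: v); split; first by apply: subspaceB => //; exact: subspaceZ.
  by rewrite scalerBr -addrA [w - _]addrC.
exists k, r.+1; rewrite addnS -dE imE; split=> //; last exact: has_dimS.
suff -> : U `&` [set u | f u = 0] = U' `&` [set u | f u = 0] by [].
apply/seteqP; split=> x [Ux fx]; split=> //; last by rewrite UE; exact: sub_adjoin.
move: Ux fx; rewrite UE => -[a [w [U'w ->]]] /=; rewrite flin => fx.
have [->|an0] := eqVneq a 0; first by rewrite scale0r add0r.
exfalso; apply: Nfu; exists (- a^-1 *: w); first exact: subspaceZ.
have := flin (- a^-1) w 0; rewrite addr0 f0 addr0 => ->.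
move/eqP: fx; rewrite addrC addr_eq0 => /eqP ->.
by rewrite scaleNr scalerN opprK scalerA mulVf// scale1r.
Qed.

End RankNullity.

(** * Orthogonal expansions along a chain of subspaces *)

Section InnerProduct.
Context (R : realType) (V : lmodType R[i]) (ip : V -> V -> R[i]).
Hypothesis ipL : forall a u v w, ip (a *: u + v) w = a * ip u w + ip v w.
Hypothesis ipC : forall u v, ip v u = conjc (ip u v).
Hypothesis ip_ge0 : forall u, 0 <= complex.Re (ip u u).
Hypothesis ip_eq0 : forall u, complex.Re (ip u u) = 0 -> u = 0.
Implicit Types (U W : set V) (u v w : V).

Local Notation sqn u := (complex.Re (ip u u)).

Definition orthc U : set V := [set w | forall u, U u -> ip w u = 0].

Lemma ipDl u v w : ip (u + v) w = ip u w + ip v w.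
Proof. by rewrite -[u]scale1r ipL mul1r scale1r. Qed.

Lemma ip0l w : ip 0 w = 0.
Proof. by have := ipL (-1) 0 0 w; rewrite scaler0 addr0 mulN1r addNr. Qed.

Lemma ipZl a u w : ip (a *: u) w = a * ip u w.
Proof. by rewrite -[_ *: _]addr0 ipL ip0l addr0. Qed.

Lemma ipBl u v w : ip (u - v) w = ip u w - ip v w.
Proof. by rewrite ipDl -scaleN1r ipZl mulN1r. Qed.

Lemma ip_sym0 u v : ip u v = 0 -> ip v u = 0.
Proof. by move=> uv; rewrite ipC uv conjc0. Qed.

Lemma ip0r w : ip w 0 = 0.
Proof. by apply: ip_sym0; exact: ip0l. Qed.

Lemma ipDr u v w : ip w (u + v) = ip w u + ip w v.
Proof. by rewrite ipC ipDl rmorphD /= -!ipC. Qed.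

Lemma ipZr a u w : ip w (a *: u) = conjc a * ip w u.
Proof. by rewrite ipC ipZl rmorphM /= -!ipC. Qed.

Lemma ipBr u v w : ip w (u - v) = ip w u - ip w v.
Proof. by rewrite ipC ipBl rmorphB /= -!ipC. Qed.

Lemma sqnD u v : ip u v = 0 -> sqn (u + v) = sqn u + sqn v.
Proof. by move=> uv; rewrite ipDl !ipDr uv (ip_sym0 uv) add0r addr0 raddfD. Qed.

Lemma parallelogram u v : sqn (u - v) + sqn (u + v) = 2 * sqn u + 2 * sqn v.
Proof.
have e4 : ip (u - v) (u - v) + ip (u + v) (u + v) =
    (ip u u + ip u u) + (ip v v + ip v v).
  rewrite ipBl ipDl !ipBr !ipDr.
  move: (ip u u) (ip u v) (ip v u) (ip v v) => x y z t; ring.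
by have := congr1 (@complex.Re R) e4; rewrite !raddfD /= => ->; ring.
Qed.

Lemma ip_sqn_neq0 u : u != 0 -> ip u u != 0.
Proof. by apply: contra_neq => uu; apply: ip_eq0; rewrite uu. Qed.

Lemma orthc_subspace U : is_subspace (orthc U).
Proof.
split=> [u _|a u v uU vU w Uw]; first exact: ip0l.
by rewrite ipL uU// vU// mulr0 addr0.
Qed.

Lemma orthc_cap0 U u : U u -> orthc U u -> u = 0.
Proof. by move=> Uu /(_ u Uu) uu; apply: ip_eq0; rewrite uu. Qed.

(** Gram-Schmidt by induction: if U = U' + C b, replace b by c, the difference of b
    and its projection onto U', and add to the projection of u onto U' its
    component along c. *)
Lemma orthogonal_projection U d : has_dim U d ->
  forall u, exists2 p, U p & orthc U (u - p).
Proof.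
elim: d U => [|d IH] U Ud u.
  rewrite (has_dim0_eq Ud); exists 0 => // v ->; exact: ip0r.
have [U' [b [U'd NU'b UE]]] := has_dimS_inv Ud.
have U'S := has_dim_subspace U'd.
have [q U'q qorth] := IH _ U'd b.
have [p U'p porth] := IH _ U'd u.
(* c spans the orthogonal complement of U' in U *)
set c := b - q in qorth.
have cn0 : c != 0.
  by apply/eqP => /eqP; rewrite subr_eq0 => /eqP bq; apply: NU'b; rewrite bq.
have ccn0 := ip_sqn_neq0 cn0.
pose t := ip (u - p) c / ip c c.
have UP x : U x -> exists a v, U' v /\ x = a *: c + v.
  rewrite UE => -[a [v [U'v ->]]]; exists a, (a *: q + v).
  by split; [exact: U'S.2|rewrite scalerBr addrA subrK].
exists (t *: c + p).
  rewrite UE; exists t, (p - t *: q); split.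
    by apply: subspaceB => //; exact: subspaceZ.
  by rewrite scalerBr -addrA [- _ + _]addrC.
move=> x /UP[a [v [U'v ->]]].
rewrite opprD addrA addrAC ipBl !ipDr !ipZr !ipZl (porth _ U'v) (qorth _ U'v).
by rewrite mulr0 !addr0 /t divfK// subrr.
Qed.

Lemma best_approximation U u p v : is_subspace U -> U p -> orthc U (u - p) ->
  U v -> sqn (u - p) <= sqn (u - v).
Proof.
move=> US Up uorth Uv; have -> : u - v = (u - p) + (p - v) by rewrite addrA subrK.
by rewrite [leRHS]sqnD ?lerDl ?ip_ge0//; exact: (uorth _ (subspaceB US Up Uv)).
Qed.

Section Chain.
Variable A : nat -> set V.
Hypothesis A0 : A 0 = [set 0].
Hypothesis Adim : forall n, exists d, has_dim (A n) d.
Hypothesis Amono : forall n, A n `<=` A n.+1.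

Definition increment m := A m.+1 `&` orthc (A m).
Local Notation W := increment.

Lemma chain_subspace n : is_subspace (A n).
Proof. by have [d /has_dim_subspace] := Adim n. Qed.

Lemma chain_mono m n : (m <= n)%N -> A m `<=` A n.
Proof.
move=> /subnK <-; elim: (n - m)%N => // k IH.
by apply: subset_trans IH _; rewrite addSn; exact: Amono.
Qed.

Lemma increment_subspace m : is_subspace (W m).
Proof. by apply: subspace_setI; [exact: chain_subspace|exact: orthc_subspace]. Qed.

Lemma increment_dim m : exists d, has_dim (W m) d.
Proof.
have [d Ad] := Adim m.+1.
by apply: has_dim_sub Ad (increment_subspace m) _ => x [].
Qed.

Lemma increment_decomposition m : A m.+1 = sum_set (A m) (W m).
Proof.
apply/seteqP; split=> x; last first.
  move=> [u [w [Au [Aw _] ->]]]; apply: subspaceD => //; first exact: chain_subspace.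
  exact: Amono.
move=> Ax; have [d /orthogonal_projection/(_ x)[p Ap xp]] := Adim m.
exists p, (x - p); split=> //; last by rewrite addrC subrK.
by split=> //; apply: subspaceB => //; [exact: chain_subspace|exact: Amono].
Qed.

Lemma chain_cap_increment m : A m `&` W m = [set 0].
Proof.
apply/seteqP; split=> [x [Ax [_ xo]]|_ ->]; first exact: orthc_cap0 xo.
by split; [case: (chain_subspace m)|case: (increment_subspace m)].
Qed.

Lemma increments_orth m l u w : m != l -> W m u -> W l w -> ip u w = 0.
Proof.
have lt_orth k j x y : (k < j)%N -> W k x -> W j y -> ip y x = 0.
  by move=> kj [Ax _] [_ yo]; exact: (yo _ (chain_mono kj Ax)).
rewrite neq_ltn => /orP[ml|lm] Wu Ww; last exact: lt_orth lm Ww Wu.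
by apply: ip_sym0; exact: lt_orth ml Wu Ww.
Qed.

Lemma chain_sum n (w : nat -> V) : (forall m, W m (w m)) -> A n (\sum_(m < n) w m).
Proof.
move=> Ww; apply: subspace_sum => [|i]; first exact: chain_subspace.
by apply: chain_mono (ltn_ord i) _ _; case: (Ww i).
Qed.

Lemma chain_orth n u : (forall m, (m < n)%N -> orthc (W m) u) -> orthc (A n) u.
Proof.
elim: n => [_ v|n IH uo v]; first by rewrite A0 => ->; exact: ip0r.
rewrite increment_decomposition => -[a [w [Aa Ww ->]]].
by rewrite ipDr (uo n _ w Ww)// addr0 IH// => m mn; exact: (uo _ (ltnW mn)).
Qed.

(** Pythagoras. Applied to the difference of two expansions of one vector, it makes
    the coefficients of the expansion unique. *)
Lemma coefficient_sum n (w : nat -> V) k : (forall m, W m (w m)) -> (k < n)%N ->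
  sqn (w k) <= sqn (\sum_(m < n) w m).
Proof.
move=> Ww kn; pose k' := Ordinal kn; rewrite (bigD1 k')//= [leRHS]sqnD ?lerDl ?ip_ge0//.
apply: ip_sym0.
elim/big_ind : _ => [|x y x0 y0|i ik]; first exact: ip0l.
  by rewrite ipDl x0 y0 addr0.
by apply: increments_orth (Ww i) (Ww k); rewrite -val_eqE in ik.
Qed.

Lemma sqrt_cvg0P (f : nat -> R) : (forall n, 0 <= f n) ->
  (fun n => Num.sqrt (f n)) @ \oo --> (0 : R) <->
  forall e, 0 < e -> exists m, forall n, (m <= n)%N -> f n < e.
Proof.
move=> f0; split=> [/cvgrPdist_lt h e e0|h].
  have se0 : 0 < Num.sqrt e by rewrite sqrtr_gt0.
  have [m _ hm] := h _ se0; exists m => n mn.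
  have := hm n mn; rewrite /= sub0r normrN ger0_norm ?sqrtr_ge0//.
  by rewrite ltr_sqrt.
apply/cvgrPdist_lt => e e0; have [m hm] := h _ (exprn_gt0 2 e0).
exists m => // n mn /=; rewrite sub0r normrN ger0_norm ?sqrtr_ge0//.
by rewrite -[e]gtr0_norm// -sqrtr_sqr ltr_sqrt ?exprn_gt0//; exact: hm.
Qed.

(** With p the projection of u onto U, the squared distances from u to the points u_ n
    are at least that of u - p, which is thus 0. *)
Lemma subspace_closed U d (u_ : nat -> V) u : has_dim U d -> (forall n, U (u_ n)) ->
  (fun n => Num.sqrt (sqn (u_ n - u))) @ \oo --> (0 : R) -> U u.
Proof.
move=> Ud Uu /sqrt_cvg0P h; have US := has_dim_subspace Ud.
have [p Up uo] := orthogonal_projection Ud u.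
suff /eqP : u - p = 0 by rewrite subr_eq0 => /eqP ->.
apply: ip_eq0; apply/eqP; rewrite eq_le ip_ge0 andbT; apply/ler_addgt0Pr => e e0.
have [m /(_ m (leqnn m)) hm] := h (fun=> ip_ge0 _) e e0.
rewrite add0r; apply: le_trans (best_approximation US Up uo (Uu m)) _.
by rewrite -opprB -scaleN1r ipZl ipZr rmorphN1 mulN1r mulN1r opprK ltW.
Qed.

Hypothesis Adense : forall u e, 0 < e -> exists n v, A n v /\ sqn (u - v) < e.

(** The sum of the projections of u onto the first n increments is the projection
    of u onto A n, hence the best approximation of u in A n; density of the chain
    makes these tend to u. *)
Lemma orthogonal_expansion u : exists! w : nat -> V,
  (forall m, W m (w m)) /\
  (fun n => Num.sqrt (sqn (\sum_(m < n) w m - u))) @ \oo --> (0 : R).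
Proof.
have sqnN v : sqn (- v) = sqn v.
  by rewrite -scaleN1r ipZl ipZr rmorphN1 mulN1r mulN1r opprK.
have [w Ww wo] : exists2 w : nat -> V, (forall m, W m (w m)) &
    forall m, orthc (W m) (u - w m).
  have /choice[w wP] m : exists p, W m p /\ orthc (W m) (u - p).
    have [d Wd] := increment_dim m.
    by have [p Wp up] := orthogonal_projection Wd u; exists p.
  by exists w => m; have [] := wP m.
have wu : (fun n => Num.sqrt (sqn (\sum_(m < n) w m - u))) @ \oo --> (0 : R).
  apply/sqrt_cvg0P => [n|e e0]; first exact: ip_ge0.
  have [k [v [Av uv]]] := Adense u e0; exists k => n kn.
  rewrite -sqnN opprB; apply: le_lt_trans uv.
  apply: (best_approximation (chain_subspace n) (chain_sum n Ww) _ (chain_mono kn Av)).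
  apply: chain_orth => m mn x Wx.
  rewrite (bigD1 (Ordinal mn))//= opprD addrA ipBl (wo m)// sub0r.
  apply/eqP; rewrite oppr_eq0; apply/eqP.
  elim/big_ind : _ => [|y z y0 z0|i ik]; first exact: ip0l.
    by rewrite ipDl y0 z0 addr0.
  by apply: increments_orth (Ww i) Wx; rewrite -val_eqE in ik.
exists w; split=> //.
move=> w' [Ww' w'u]; apply/funext => k; apply/eqP; rewrite -subr_eq0; apply/eqP.
have Wz m : W m (w m - w' m) by apply: subspaceB => //; exact: increment_subspace.
apply: ip_eq0; apply/eqP; rewrite eq_le ip_ge0 andbT; apply/ler_addgt0Pr => e e0.
have e40 : 0 < e / 4 by rewrite divr_gt0.
move: wu w'u => /sqrt_cvg0P-/(_ (fun=> ip_ge0 _) _ e40)[m1 h1].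
move=> /sqrt_cvg0P-/(_ (fun=> ip_ge0 _) _ e40)[m2 h2].
pose n := maxn k.+1 (maxn m1 m2).
set b := \sum_(m < n) w m - u; set b' := \sum_(m < n) w' m - u.
have bb : sqn b < e / 4 by apply: h1; rewrite !leq_max leqnn orbT.
have bb' : sqn b' < e / 4 by apply: h2; rewrite !leq_max leqnn !orbT.
rewrite add0r.
apply: le_trans (coefficient_sum Wz (leq_maxl _ _ : (k < n)%N)) _.
have -> : \sum_(m < n) (w m - w' m) = b - b'.
  by rewrite /b /b' opprB addrA subrK sumrB.
have := parallelogram b b'.
have := ip_ge0 (b + b'); lra.
Qed.

End Chain.
End InnerProduct.

(** * Homogeneous polynomials *)

Lemma digits_inj n B (f g : 'I_n -> nat) :
  (forall i, f i < B)%N -> (forall i, g i < B)%N ->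
  (\sum_i f i * B ^ i = \sum_i g i * B ^ i)%N -> f =1 g.
Proof.
elim: n f g => [|n IH] f g fB gB; first by move=> _ [].
have B0 : (0 < B)%N by apply: leq_trans (fB ord0).
have step (h : 'I_n.+1 -> nat) : (\sum_i h i * B ^ i =
    (\sum_i h (lift ord0 i) * B ^ i) * B + h ord0)%N.
  rewrite big_ord_recl expn0 muln1 addnC big_distrl /=; congr (_ + _)%N.
  by apply: eq_bigr => i _; rewrite -mulnA -expnSr.
rewrite !step => fg.
have e0 : f ord0 = g ord0.
  by have := congr1 (modn^~ B) fg; rewrite !modnMDl !modn_small.
move/eqP: fg; rewrite e0 eqn_add2r eqn_pmul2r// => /eqP/IH IH' i.
case: (unliftP ord0 i) => [j ->|->]; last by [].
by apply: IH' => k; [exact: fB|exact: gB].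
Qed.

Section Polynomials.
Context (R : realType).

(** Kronecker substitution: with B larger than every exponent of p, replacing x_i by
    t ^ (B ^ i) sends distinct monomials to distinct powers of t ([digits_inj]),
    which gives a univariate polynomial with infinitely many roots. *)
Lemma meval_real_eq0 n (p : mpoly n R[i]) :
  (forall x : 'I_n -> R, meval (fun i => (x i)%:C%C) p = 0) -> p = 0.
Proof.
move=> p0; pose B := msize p.
pose k (m : multinom n) := (\sum_i m i * B ^ i)%N.
have k_inj : {in msupp p &, injective k}.
  have lt_B (m : multinom n) : m \in msupp p -> forall i, (m i < B)%N.
    move=> mp i; apply: leq_ltn_trans (msize_mdeg_lt mp).
    by rewrite mdegE (bigD1 i)//= leq_addr.
  move=> m m' mp m'p kmm'; apply/mnmP.
  by apply: (digits_inj _ _ kmm') => i; exact: lt_B.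
pose P : {poly R[i]} := \sum_(m <- msupp p) mcoeff m p *: 'X^(k m).
have P0 (t : R) : P.[t%:C%C] = 0.
  rewrite /P horner_sum -[RHS](p0 (fun i => t ^+ (B ^ i))) mevalE.
  apply: eq_bigr => m _; rewrite hornerZ hornerXn; congr (_ * _).
  rewrite /k expr_sum; apply: eq_bigr => i _.
  by rewrite rmorphXn /= -exprM mulnC.
have {}P0 : P = 0.
  apply/eqP; apply: contraT => Pn0.
  pose s : seq R[i] := [seq (j%:R : R)%:C%C | j <- iota 0 (size P)].
  have := @max_poly_roots _ P s Pn0; rewrite size_map size_iota ltnn; apply.
    by apply/allP => _ /mapP[j _ ->]; rewrite rootE P0.
  apply/(map_uniq (f := @complex.Re R)).
  rewrite -map_comp map_inj_uniq ?iota_uniq// => i j /= /eqP.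
  by rewrite eqr_nat => /eqP.
apply/mpolyP => m; rewrite mcoeff0; have [mp|] := boolP (m \in msupp p); last first.
  exact: memN_msupp_eq0.
have := congr1 (fun Q : {poly R[i]} => Q`_(k m)) P0.
rewrite coef0 /P coef_sum (bigD1_seq m)//= coefZ coefXn eqxx mulr1.
rewrite big_seq_cond big1 ?addr0// => m' /andP[m'p m'm].
rewrite coefZ coefXn; case: eqP => [/k_inj|]; last by rewrite mulr0.
by move=> /(_ mp m'p) mm'; rewrite mm' eqxx in m'm.
Qed.

Context (G : carnot R).
Local Notation cpoly := (mpoly (gdim G) R[i]).
Implicit Types (p q : cpoly) (x : 'rV[R]_(gdim G)).

Lemma peval_eq0 p : (forall x, peval p x = 0) -> p = 0.
Proof.
move=> p0; apply: meval_real_eq0 => x; rewrite -[RHS](p0 (\row_i x i)).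
by apply: meval_eq => i; rewrite mxE.
Qed.

Lemma pevalD p q x : peval (p + q) x = peval p x + peval q x.
Proof. exact: mevalD. Qed.

Lemma pevalM p q x : peval (p * q) x = peval p x * peval q x.
Proof. exact: mevalM. Qed.

Lemma pevalZ a p x : peval (a *: p) x = a * peval p x.
Proof. exact: mevalZ. Qed.

Lemma peval0 x : peval (0 : cpoly) x = 0.
Proof. exact: meval0. Qed.

Lemma peval_sum (I : Type) (r : seq I) (P : pred I) (F : I -> cpoly) x :
  peval (\sum_(i <- r | P i) F i) x = \sum_(i <- r | P i) peval (F i) x.
Proof. exact: (raddf_sum (meval _)). Qed.

Definition wdeg (m : multinom (gdim G)) := (\sum_i weight i * m i)%N.

Lemma peval_dil p (r : R) x : peval p (dil r x) =
  \sum_(m <- msupp p) mcoeff m p * r%:C%C ^+ wdeg m * \prod_i (x ord0 i)%:C%C ^+ m i.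
Proof.
rewrite /peval mevalE; apply: eq_bigr => m _; rewrite -mulrA; congr (_ * _).
rewrite /wdeg expr_sum -big_split; apply: eq_bigr => i _ /=.
by rewrite mxE rmorphM /= exprMn rmorphXn /= -exprM.
Qed.

Lemma mpolyX_homogeneous m : Defs.polyP G (wdeg m) (mpolyX R[i] m).
Proof.
move=> r x r0; rewrite peval_dil msuppX big_seq1 mcoeffX eqxx mul1r.
by rewrite /peval mevalX rmorphXn.
Qed.

(** Dilating by 2 multiplies the monomial m by 2 ^ wdeg m, while homogeneity
    multiplies it by 2 ^ j. *)
Lemma homogeneous_wdeg p j m : Defs.polyP G j p -> m \in msupp p -> wdeg m = j.
Proof.
move=> pj mp.
pose q : cpoly :=
  \sum_(m <- msupp p) (mcoeff m p * (2 ^+ wdeg m - 2 ^+ j)) *: mpolyX _ m.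
have q0 : q = 0.
  apply: peval_eq0 => x; have := pj 2 x (ltr0Sn _ 1).
  rewrite peval_dil => /eqP; rewrite -subr_eq0 => /eqP e; rewrite -[RHS]e.
  rewrite {2}/peval mevalE mulr_sumr -sumrB /q peval_sum.
  have two : (2 : R)%:C%C = 2 :> R[i] by exact: (rmorph_nat (real_complex R) 2).
  have twoX : (2 ^+ j : R)%:C%C = 2 ^+ j :> R[i] by rewrite rmorphXn /= two.
  apply: eq_bigr => m' _; rewrite pevalZ /peval mevalX two twoX.
  move: (mcoeff m' p) (2 ^+ wdeg m') (2 ^+ j) (\prod_i _) => c a b d.
  by rewrite mulrBr mulrBl mulrCA !mulrA.
have := congr1 (mcoeff m) q0; rewrite /q raddf_sum mcoeff0 /=.
rewrite (bigD1_seq m)//= mcoeffZ mcoeffX eqxx mulr1 big1_seq; last first.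
  by move=> m' /andP[m'm _]; rewrite mcoeffZ mcoeffX (negPf m'm) mulr0.
rewrite addr0 => /eqP; rewrite mulf_eq0 mcoeff_eq0 mp /= subr_eq0 => /eqP.
by apply: ieexprIn; rewrite ?ltr0Sn// gt_eqF// ltr1n.
Qed.

Lemma mdeg_le_wdeg m : (mdeg m <= wdeg m)%N.
Proof.
rewrite mdegE /wdeg; apply: leq_sum => i _; rewrite leq_pmull//.
by case/andP: (weight_bounds i).
Qed.

Lemma polyP_subspace j : is_subspace (Defs.polyP G j).
Proof.
split=> [r x _|a p q pj qj r x r0]; first by rewrite !peval0 mulr0.
by rewrite !pevalD !pevalZ pj// qj// mulrDr mulrCA.
Qed.

Lemma polyA_subspace k : is_subspace (polyA G k).
Proof.
case: k => k; last exact: subspace_set0.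
split.
  by exists (fun=> 0); split=> [j|]; [case: (polyP_subspace j)|rewrite big1].
move=> a p p' [q [qP ->]] [q' [q'P ->]]; exists (fun j => a *: q j + q' j).
split=> [j|]; first exact: (polyP_subspace j).2.
by rewrite scaler_sumr -big_split.
Qed.

Lemma polyA_mono (k l : nat) : (k <= l)%N -> polyA G k `<=` polyA G l.
Proof.
move=> kl p [q [qP ->]]; exists (fun j => if (j < k.+1)%N then q j else 0).
split=> [j|]; first by case: ifP => _ //; case: (polyP_subspace j).
by rewrite -big_mkcond -big_ord_widen.
Qed.

Lemma polyP_polyA (k : nat) : Defs.polyP G k `<=` polyA G k.
Proof.
move=> p pk; exists (fun j => if j == k then p else 0); split=> [j|].
  by case: eqP => [->|_] //; case: (polyP_subspace j).
rewrite big_ord_recr/= eqxx big1 ?add0r// => i _.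
by rewrite (ltn_eqF (ltn_ord i)).
Qed.

Lemma polyA_exhaust p : exists k : nat, polyA G k p.
Proof.
rewrite (mpolyE p); elim/big_ind : _ => [|p1 p2 [k pk] [l pl]|m _].
- by exists 0%N; case: (polyA_subspace 0%N).
- exists (maxn k l); apply: subspaceD; first exact: polyA_subspace.
    by apply: polyA_mono pk; exact: leq_maxl.
  by apply: polyA_mono pl; exact: leq_maxr.
- exists (wdeg m); apply: subspaceZ; first exact: polyA_subspace.
  by apply: polyP_polyA; exact: mpolyX_homogeneous.
Qed.

Lemma polyA_msize (k : nat) p : polyA G k p -> (msize p <= k.+1)%N.
Proof.
move=> [q [qP ->]]; apply: leq_trans (msize_sum _ _ _) _.
apply/bigmax_leqP => j _; rewrite msizeE; apply/bigmax_leqP_seq => m mq _.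
rewrite ltnS; apply: leq_trans (mdeg_le_wdeg m) _.
by rewrite (homogeneous_wdeg (qP j) mq) -ltnS.
Qed.

Lemma polyA_has_dim k : exists d, has_dim (polyA G k) d.
Proof.
case: k => [k|k]; last by exists 0%N; exact: has_dim0.
have [d bd] := has_dim_span
  (fun i : 'I_#|{: bmultinom (gdim G) k.+1}| => mpolyX R[i] (enum_val i)).
apply: has_dim_sub bd (polyA_subspace k) _ => p /polyA_msize pk.
exists (fun i : 'I_#|{: bmultinom (gdim G) k.+1}| => mcoeff (enum_val i) p) => //.
rewrite [RHS](mpolywE pk) [RHS](reindex (@enum_val _ (mem {: bmultinom _ _})))//=.
exact/onW_bij/enum_val_bij.
Qed.

End Polynomials.

(** * Square-mean approximation by an algebra of functions *)

Section SignIteration.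
Context (R : realType).
Implicit Types x y : R.

(** The Newton-Schulz iteration for the sign: -1, 0 and 1 are fixed, and every
    point of ]0, 1] is attracted by 1. *)
Definition sgn_step x : R := x * (3 - x ^+ 2) / 2.

Lemma sgn_stepN x : sgn_step (- x) = - sgn_step x.
Proof. by rewrite /sgn_step sqrrN !mulNr. Qed.

Lemma sgn_step_bound x : `|x| <= 1 -> `|sgn_step x| <= 1.
Proof.
rewrite /sgn_step !ler_norml => /andP[x1 x2]; apply/andP; split.
  rewrite -subr_ge0.
  have -> : x * (3 - x ^+ 2) / 2 - (-1) = (x + 1) ^+ 2 * (2 - x) / 2 by field.
  by rewrite divr_ge0// mulr_ge0 ?sqr_ge0//; lra.
rewrite -subr_ge0.
have -> : 1 - x * (3 - x ^+ 2) / 2 = (1 - x) ^+ 2 * (2 + x) / 2 by field.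
by rewrite divr_ge0// mulr_ge0 ?sqr_ge0//; lra.
Qed.

(** The identity 1 - sgn_step y = (1 - y / 2 - y ^ 2 / 2) * (1 - y) and y >= x show
    that the distance to 1 decreases at least by the factor 1 - x / 2. *)
Lemma iter_sgn_step_pos x n : 0 < x -> x <= 1 ->
  x <= iter n sgn_step x <= 1 /\ 1 - iter n sgn_step x <= (1 - x / 2) ^+ n.
Proof.
move=> x0 x1; elim: n => [|n [/andP[xy y1] IH]] /=.
  by rewrite expr0 lexx x1; split=> //; lra.
set y := iter n _ x in xy y1 IH *.
have y0 : 0 < y by exact: lt_le_trans xy.
have sy1 : sgn_step y <= 1.
  by have := @sgn_step_bound y; rewrite !ler_norml => /(_ _)/andP[]// ; lra.
have ysy : y <= sgn_step y.
  rewrite -subr_ge0 /sgn_step.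
  have -> : y * (3 - y ^+ 2) / 2 - y = y * (1 - y) * (1 + y) / 2 by field.
  by rewrite divr_ge0// !mulr_ge0//; lra.
rewrite sy1 (le_trans xy ysy); split=> //.
have -> : 1 - sgn_step y = (1 - y / 2 - y ^+ 2 / 2) * (1 - y).
  by rewrite /sgn_step; field.
rewrite [leRHS]exprS; apply: ler_pM => //; [|lra|].
  have : y ^+ 2 <= 1 by rewrite expr_le1// ltW.
  lra.
have := sqr_ge0 y; lra.
Qed.

Lemma cvg_iter_sgn_step x : `|x| <= 1 ->
  (fun n => iter n sgn_step x) @ \oo --> Num.sg x.
Proof.
have pos y : 0 < y -> y <= 1 -> (fun n => iter n sgn_step y) @ \oo --> (1 : R).
  move=> y0 y1; apply: (@squeeze_cvgr _ _ _ _ (fun n => 1 - (1 - y / 2) ^+ n) (cst 1)).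
  - apply: nearW => n; have [/andP[_ ->] h] := iter_sgn_step_pos n y0 y1.
    by rewrite andbT; lra.
  - rewrite -[X in _ --> X]subr0; apply: cvgB; first exact: cvg_cst.
    by apply: cvg_expr; rewrite ger0_norm; lra.
  - exact: cvg_cst.
rewrite ler_norml => /andP[x1 x2].
have [x0|x0|->] := ltgtP x 0.
- rewrite (ltr0_sg x0).
  have -> : (fun n => iter n sgn_step x) = (fun n => - iter n sgn_step (- x)).
    apply/funext => n; elim: n => [|n IH] /=; first by rewrite opprK.
    by rewrite IH sgn_stepN.
  by apply: cvgN; apply: pos; lra.
- by rewrite (gtr0_sg x0); exact: pos.
- rewrite sgr0; have -> : (fun n => iter n sgn_step 0) = cst 0; last exact: cvg_cst.
  by apply/funext; elim=> //= n ->; rewrite /sgn_step !mul0r.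
Qed.

End SignIteration.

Section L2Approximation.
Context d (T : measurableType d) (R : realType).
Context (mu : {finite_measure set T -> \bar R}) (K : set T) (mK : measurable K).
Context (P : set (T -> R)).
Hypothesis P_cst : forall c, P (cst c).
Hypothesis P_add : forall f g, P f -> P g -> P (f \+ g).
Hypothesis P_mul : forall f g, P f -> P g -> P (f \* g).
Hypothesis P_meas : forall f, P f -> measurable_fun setT f.
Hypothesis P_bnd : forall f, P f -> exists M : R, forall x, K x -> `|f x| <= M.
Implicit Types (f g h : T -> R).

Definition sqint f : \bar R := (\int[mu]_(x in K) ((f x) ^+ 2)%:E)%E.

(** Membership in the closure of the algebra P for the square mean on K. *)
Definition approximable f := measurable_fun setT f /\
  forall e : R, 0 < e -> exists2 h, P h & (sqint (f \- h)%R < e%:E)%E.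

Let msq f : measurable_fun setT f ->
  measurable_fun K (fun x => (f x ^+ 2 : R)%:E).
Proof.
by move=> mf; apply/measurable_EFinP; apply: measurable_funX; exact: measurable_funTS.
Qed.

Lemma sqint_ge0 f : (0 <= sqint f)%E.
Proof. by apply: integral_ge0 => x _; rewrite lee_fin sqr_ge0. Qed.

Lemma eq_sqint f g : {in K, f =1 g} -> sqint f = sqint g.
Proof. by move=> fg; apply: eq_integral => x xK; rewrite fg. Qed.

Lemma sqint_add f g : measurable_fun setT f -> measurable_fun setT g ->
  (sqint (f \+ g)%R <= 2%:E * sqint f + 2%:E * sqint g)%E.
Proof.
move=> mf mg; rewrite /sqint -!ge0_integralZl//; try by [exact: msq|
  move=> x _; rewrite lee_fin sqr_ge0].
rewrite -ge0_integralD//; first last.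
- by apply: measurable_funeM; exact: msq.
- by move=> x _; rewrite -EFinM lee_fin mulr_ge0 ?sqr_ge0.
- by apply: measurable_funeM; exact: msq.
- by move=> x _; rewrite -EFinM lee_fin mulr_ge0 ?sqr_ge0.
apply: ge0_le_integral => //.
- by move=> x _; rewrite lee_fin sqr_ge0.
- by apply: msq; exact: measurable_funD.
- by apply: emeasurable_funD; apply: measurable_funeM; exact: msq.
- move=> x _ /=; rewrite -!EFinM -EFinD lee_fin.
  by have := sqr_ge0 (f x - g x); rewrite sqrrB sqrrD; lra.
Qed.

Lemma sqint_mul f g (M : R) : measurable_fun setT f -> measurable_fun setT g ->
  (forall x, K x -> `|g x| <= M) -> (sqint (f \* g)%R <= (M ^+ 2)%:E * sqint f)%E.
Proof.
move=> mf mg gM; rewrite /sqint -ge0_integralZl//; first last.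
- by rewrite lee_fin sqr_ge0.
- by move=> x _; rewrite lee_fin sqr_ge0.
- exact: msq.
apply: ge0_le_integral => //.
- by move=> x _; rewrite lee_fin sqr_ge0.
- by apply: msq; exact: measurable_funM.
- by apply: measurable_funeM; exact: msq.
- move=> x Kx /=; rewrite -EFinM lee_fin exprMn mulrC ler_wpM2r ?sqr_ge0//.
  by rewrite -[leLHS]real_normK ?num_real// lerXn2r ?nnegrE// ?gM//
    (le_trans _ (gM _ Kx)).
Qed.

Let lt_quarters (a b : \bar R) (e : R) : (0 <= a)%E -> (0 <= b)%E ->
  (a < (e / 4)%:E)%E -> (b < (e / 4)%:E)%E -> (2%:E * a + 2%:E * b < e%:E)%E.
Proof.
case: a b => [a| |] [b| |]//; rewrite -!EFinM -EFinD !lte_fin => _ _; lra.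
Qed.

Lemma approximable_P f : P f -> approximable f.
Proof.
move=> Pf; split=> [|e e0]; first exact: P_meas.
exists f => //; rewrite /sqint integral0_eq ?lte_fin// => x _ /=.
by rewrite subrr expr0n.
Qed.

Lemma approximable_limit f : measurable_fun setT f ->
  (forall e : R, 0 < e -> exists2 g, approximable g & (sqint (f \- g)%R < e%:E)%E) ->
  approximable f.
Proof.
move=> mf fa; split=> // e e0; have e40 : 0 < e / 4 by rewrite divr_gt0.
have [g [mg ga] fg] := fa _ e40; have [h Ph gh] := ga _ e40.
exists h => //; have mh := P_meas Ph.
rewrite (@eq_sqint _ ((f \- g) \+ (g \- h))); last by move=> x _ /=; rewrite addrA subrK.
apply: le_lt_trans (sqint_add _ _) _; try exact: measurable_funB.
by apply: lt_quarters => //; exact: sqint_ge0.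
Qed.

Lemma approximable_add f g : approximable f -> approximable g ->
  approximable (f \+ g).
Proof.
move=> [mf fa] [mg ga]; split=> [|e e0]; first exact: measurable_funD.
have e40 : 0 < e / 4 by rewrite divr_gt0.
have [h Ph fh] := fa _ e40; have [k Pk gk] := ga _ e40.
have [mh mk] := (P_meas Ph, P_meas Pk).
exists (h \+ k); first exact: P_add.
rewrite (@eq_sqint _ ((f \- h) \+ (g \- k))); last first.
  by move=> x _ /=; rewrite opprD addrACA.
apply: le_lt_trans (sqint_add _ _) _; try exact: measurable_funB.
by apply: lt_quarters => //; exact: sqint_ge0.
Qed.

Definition bounded_approximable f :=
  approximable f /\ exists M : R, forall x, K x -> `|f x| <= M.

Let lt_mul_sq (M e : R) (a : \bar R) : 0 < e -> (0 <= a)%E ->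
  (a < (e / (M ^+ 2 + 1))%:E -> (M ^+ 2)%:E * a < e%:E)%E.
Proof.
move=> e0; case: a => [a| |]//; rewrite ?lee_fin -?EFinM !lte_fin => a0.
have M1 : 0 < M ^+ 2 + 1 by rewrite ltr_wpDl ?sqr_ge0.
rewrite ltr_pdivlMr// => ae.
apply: le_lt_trans ae; rewrite mulrC ler_wpM2l//; lra.
Qed.

(** Approximate g by h in P, then f by k in P. The error f * (g - h) is controlled by
    the bound of f, and the error (f - k) * h by the bound of h. *)
Lemma bounded_approximable_mul f g :
  bounded_approximable f -> bounded_approximable g ->
  bounded_approximable (f \* g).
Proof.
move=> [[mf fa] [M fM]] [[mg ga] [M' gM']]; split; last first.
  by exists (M * M') => x Kx; rewrite normrM ler_pM ?fM ?gM'.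
have sq0 (L e : R) : 0 < e -> 0 < e / (L ^+ 2 + 1).
  by move=> e0; rewrite divr_gt0// ltr_wpDl ?sqr_ge0.
apply: approximable_limit => [|e e0]; first exact: measurable_funM.
have [h Ph gh] := ga _ (sq0 M _ e0); have mh := P_meas Ph.
(* f * h need not belong to P: conclude through [approximable_limit] *)
exists (f \* h); last first.
  rewrite (@eq_sqint _ ((g \- h) \* f)); last first.
    by move=> x _ /=; rewrite mulrBl ![_ * f x]mulrC.
  apply: le_lt_trans (sqint_mul _ mf fM) _; first exact: measurable_funB.
  by apply: lt_mul_sq => //; exact: sqint_ge0.
split=> [|e' e'0]; first exact: measurable_funM.
have [L hL] := P_bnd Ph.
have [k Pk fk] := fa _ (sq0 L _ e'0); have mk := P_meas Pk.
exists (k \* h); first exact: P_mul.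
rewrite (@eq_sqint _ ((f \- k) \* h)); last by move=> x _ /=; rewrite mulrBl.
apply: le_lt_trans (sqint_mul _ mh hL) _; first exact: measurable_funB.
by apply: lt_mul_sq => //; exact: sqint_ge0.
Qed.

Lemma approximable_dominated f (f_ : nat -> T -> R) (G : T -> R) :
  measurable_fun setT f -> (forall n, approximable (f_ n)) ->
  (forall x, K x -> f_ ^~ x @ \oo --> f x) ->
  mu.-integrable K (EFin \o G) ->
  (forall n x, K x -> (f x - f_ n x) ^+ 2 <= G x) -> approximable f.
Proof.
move=> mf f_a f_f iG fG; apply: approximable_limit => // e e0.
have := @dominated_convergence _ _ _ mu K mK
  (fun n x => ((f x - f_ n x) ^+ 2)%:E) (cst 0)%E (EFin \o G).
case => //.
- by move=> n; apply: msq; apply: measurable_funB => //; have [] := f_a n.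
- apply: aeW => x Kx; apply: cvg_EFin; first exact: nearW.
  rewrite [X in X @ _ --> _](_ : _ = (fun n => (f x - f_ n x) ^+ 2))//.
  have h : (fun n => f x - f_ n x) @ \oo --> (0 : R).
    by rewrite -(subrr (f x)); apply: cvgB; [exact: cvg_cst|exact: f_f].
  by rewrite -(mulr0 (0 : R)); under eq_fun do rewrite expr2; exact: cvgM.
- by apply: aeW => x n Kx; rewrite /= ger0_norm ?sqr_ge0// lee_fin fG.
rewrite integral0 => _ /fine_cvgP[fin0 /cvgrPdist_lt/(_ _ e0) lim0] _.
have [n [fn ln]] := filter_ex (filterI fin0 lim0).
have nE : (\int[mu]_(x in K) `|((f x - f_ n x) ^+ 2)%:E - cst 0 x| = sqint (f \- f_ n)%R)%E.
  by apply: eq_integral => x _; rewrite sube0 gee0_abs// lee_fin sqr_ge0.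
rewrite /= nE in fn ln; exists (f_ n) => //.
move: ln; rewrite sub0r normrN ger0_norm ?fine_ge0 ?sqint_ge0// => ln.
by rewrite -(fineK fn) lte_fin.
Qed.

Lemma approximable_bounded_limit f (f_ : nat -> T -> R) (M : R) :
  measurable_fun setT f -> (forall n, approximable (f_ n)) ->
  (forall x, K x -> f_ ^~ x @ \oo --> f x) ->
  (forall x, K x -> `|f x| <= M) ->
  (forall n x, K x -> `|f_ n x| <= M) -> approximable f.
Proof.
move=> mf f_a f_f fM f_M.
apply: (approximable_dominated mf f_a f_f (G := cst ((M + M) ^+ 2))).
  by apply: finite_measure_integrable_cst.
move=> n x Kx /=; rewrite -real_normK ?num_real// lerXn2r ?nnegrE//.
  by rewrite addr_ge0// (le_trans _ (fM _ Kx)).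
by apply: le_trans (ler_normB _ _) _; rewrite lerD ?fM ?f_M.
Qed.


Lemma bounded_approximable_P f : P f -> bounded_approximable f.
Proof. by move=> Pf; split; [exact: approximable_P|exact: P_bnd]. Qed.

Lemma bounded_approximable_add f g :
  bounded_approximable f -> bounded_approximable g ->
  bounded_approximable (f \+ g).
Proof.
move=> [fa [M fM]] [ga [M' gM']]; split; first exact: approximable_add.
by exists (M + M') => x Kx; rewrite (le_trans (ler_normD _ _))// lerD ?fM ?gM'.
Qed.

Lemma bounded_approximable_scale a f :
  bounded_approximable f -> bounded_approximable (fun x => a * f x).
Proof.
move=> fb; apply: (bounded_approximable_mul (f := cst a)) => //.
exact: bounded_approximable_P.
Qed.

Lemma indic_bound (A : set T) x : `|\1_A x : R| <= 1.
Proof. by rewrite indicE; case: (x \in A); rewrite ?normr1 ?normr0. Qed.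

Lemma measurable_superlevel f : measurable_fun setT f -> measurable [set x | 0 < f x].
Proof.
move=> mf; rewrite -[X in measurable X]setTI.
rewrite (_ : [set x | 0 < f x] = f @^-1` `]0, +oo[%classic).
  by apply: mf => //; exact: measurable_itv.
by apply/seteqP; split=> x /=; rewrite in_itv /= andbT.
Qed.

(** If s is the sign of g, the indicator of {g > 0} is (s ^ 2 + s) / 2. After scaling
    g into [-1, 1], s is the limit of polynomials in g that stay within [-1, 1]. *)
Lemma approximable_superlevel g : P g -> approximable (\1_[set x | 0 < g x]).
Proof.
move=> Pg; have [M gM] := P_bnd Pg.
have mA := measurable_superlevel (P_meas Pg).
pose c := (`|M| + 1)^-1; have c0 : 0 < c by rewrite invr_gt0 ltr_wpDl.
pose h n := fun x => iter n (@sgn_step R) (c * g x).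
have cg1 x : K x -> `|c * g x| <= 1.
  move=> Kx; rewrite normrM (gtr0_norm c0) ler_pdivrMl ?ltr_wpDl// mulr1.
  by rewrite (le_trans (gM _ Kx))// (le_trans (ler_norm _))// lerDl.
have h1 n x : K x -> `|h n x| <= 1.
  move=> /cg1; rewrite /h; elim: n => //= n IH cgx.
  by apply: sgn_step_bound; exact: IH.
have hb n : bounded_approximable (h n).
  elim: n => [|n IH]; first exact/bounded_approximable_scale/bounded_approximable_P.
  rewrite (_ : h n.+1 = h n \* (cst (3 / 2) \+ (fun x => - 2^-1 * (h n x * h n x)))).
    apply: bounded_approximable_mul => //; apply: bounded_approximable_add.
      exact/bounded_approximable_P/P_cst.
    apply: bounded_approximable_scale; exact: bounded_approximable_mul.
  by apply/funext => x; rewrite /h /= {1}/sgn_step; field.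
pose f_ n := fun x => 2^-1 * (h n x * h n x + h n x).
apply: (@approximable_bounded_limit _ f_ 1).
- exact: measurable_indic.
- move=> n; have [] // : bounded_approximable (f_ n).
  apply: bounded_approximable_scale; apply: bounded_approximable_add => //.
  exact: bounded_approximable_mul.
- move=> x Kx; have /cvg_iter_sgn_step hs := cg1 _ Kx.
  have -> : \1_[set x | 0 < g x] x =
      2^-1 * (Num.sg (c * g x) * Num.sg (c * g x) + Num.sg (c * g x)) :> R.
    rewrite sgrM (gtr0_sg c0) mul1r indicE; case: (ltgtP (g x) 0) => gx.
    - by rewrite memNset ?ltr0_sg//=; [lra|rewrite ltNge ltW].
    - by rewrite mem_set ?gtr0_sg//=; lra.
    - by rewrite gx sgr0 memNset/= ?gx ?ltxx//; lra.
  by apply: cvgMr; apply: cvgD => //; exact: cvgM.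
- by move=> x _; exact: indic_bound.
- move=> n x /(h1 n); rewrite /f_ normrM (@gtr0_norm _ 2^-1) ?invr_gt0// => hn.
  rewrite ler_pdivrMl// (le_trans (ler_normD _ _))// normrM.
  have : `|h n x| * `|h n x| <= 1 by rewrite mulr_ile1.
  lra.
Qed.

(** Complements and finite unions are polynomial operations on indicators; countable
    unions are bounded pointwise limits of finite ones. *)
Lemma approximable_indic_sigma_algebra :
  sigma_algebra setT [set A | measurable A /\ approximable (\1_A)].
Proof.
have indb A : approximable (\1_A) -> bounded_approximable (\1_A).
  by move=> Aa; split=> //; exists 1 => x _; exact: indic_bound.
have SU A B : measurable A /\ approximable (\1_A) ->
    measurable B /\ approximable (\1_B) ->
    measurable (A `|` B) /\ approximable (\1_(A `|` B)).
  move=> [mA Aa] [mB Ba]; split; first exact: measurableU.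
  rewrite (_ : \1_(A `|` B) =
      (\1_A \+ \1_B) \+ (fun x => -1 * (\1_A x * \1_B x))).
    have [] // : bounded_approximable
      ((\1_A \+ \1_B) \+ (fun x => -1 * (\1_A x * \1_B x))).
    apply: bounded_approximable_add.
      by apply: bounded_approximable_add; exact: indb.
    by apply: bounded_approximable_scale; apply: bounded_approximable_mul; exact: indb.
  apply/funext => x /=; rewrite !indicE in_setU.
  by case: (x \in A); case: (x \in B) => /=; ring.
split.
- split; first exact: measurable0.
  by rewrite indic0; apply: approximable_P; exact: P_cst.
- move=> A [mA Aa]; split; first exact: measurableD.
  rewrite (_ : \1_(setT `\` A) = cst 1 \+ (fun x => -1 * \1_A x)).
    apply: approximable_add; first exact/approximable_P/P_cst.
    by have [] := bounded_approximable_scale (-1) (indb _ Aa).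
  apply/funext => x /=; rewrite setTD !indicE in_setC.
  by case: (x \in A) => /=; ring.
- move=> F FS; have mF : measurable (\bigcup_k F k).
    by apply: bigcupT_measurable => k; have [] := FS k.
  split=> //; pose U n := \big[setU/set0]_(i < n) F i.
  have US n : measurable (U n) /\ approximable (\1_(U n)).
    rewrite /U; elim: n => [|n IH]; last by rewrite big_ord_recr /=; apply: SU => //; exact: FS.
    rewrite big_ord0; split; first exact: measurable0.
    by rewrite indic0; apply: approximable_P; exact: P_cst.
  apply: (@approximable_bounded_limit _ (fun n => \1_(U n)) 1).
  + exact: measurable_indic.
  + by move=> n; have [] := US n.
  + move=> x _; rewrite indicE; have [|xF] := boolP (x \in _).
      rewrite inE => -[k _ Fkx]; apply: cvg_near_cst; exists k.+1 => // n /= kn.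
      by rewrite indicE mem_set// /U -bigcup_mkord; exists k.
    apply: cvg_near_cst; apply: nearW => n; rewrite indicE memNset//.
    rewrite /U -bigcup_mkord => -[k _ Fkx].
    by move: xF; rewrite notin_setE; apply; exists k.
  + by move=> x _; exact: indic_bound.
  + by move=> n x _; exact: indic_bound.
Qed.

Hypothesis P_generates : forall S : set (set T), sigma_algebra setT S ->
  (forall g, P g -> S [set x | 0 < g x]) -> forall A, measurable A -> S A.

Lemma approximable_indic A : measurable A -> approximable (\1_A).
Proof.
move=> mA.
have superlevel g : P g ->
    [set A | measurable A /\ approximable (\1_A)] [set x | 0 < g x].
  move=> Pg; split; last exact: approximable_superlevel.
  exact: measurable_superlevel (P_meas Pg).
by have [] := P_generates approximable_indic_sigma_algebra superlevel mA.
Qed.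

Import HBNNSimple.

Lemma approximable_nnsfun (f : {nnsfun T >-> R}) : approximable f.
Proof.
have sumb (r : seq R) (F : R -> T -> R) : (forall i, bounded_approximable (F i)) ->
    bounded_approximable (fun x => \sum_(i <- r) F i x).
  move=> Fb; elim: r => [|y r IH].
    by under eq_fun do rewrite big_nil; apply: bounded_approximable_P; exact: P_cst.
  by under eq_fun do rewrite big_cons; exact: bounded_approximable_add.
have -> : (f : T -> R) = fun x => \sum_(y <- fset_set (range f))
    (y * \1_(f @^-1` [set y]) x).
  by apply/funext => x; rewrite fimfunE fsbig_finite.
have [] // : bounded_approximable (fun x => \sum_(y <- fset_set (range f))
    (y * \1_(f @^-1` [set y]) x)).
apply: sumb => y; apply: bounded_approximable_scale; split.
  by apply: approximable_indic; exact: measurable_funPTI.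
by exists 1 => x _; exact: indic_bound.
Qed.

(** The simple functions g increasing to f satisfy (f - g) ^ 2 <= f ^ 2, so dominated
    convergence applies. *)
Lemma approximable_ge0 f : measurable_fun setT f -> (forall x, 0 <= f x) ->
  (sqint f < +oo)%E -> approximable f.
Proof.
move=> mf f0 ff; have mEf : measurable_fun setT (EFin \o f) by exact/measurable_EFinP.
pose f_ := nnsfun_approx measurableT mEf.
have f0' x : setT x -> (0 <= (EFin \o f) x)%E by rewrite lee_fin.
apply: (approximable_dominated (f_ := f_) (G := fun x => f x ^+ 2)) => //.
- by move=> n; exact: approximable_nnsfun.
- by move=> x _; have /fine_cvgP[] := cvg_nnsfun_approx measurableT mEf f0' (I : setT x).
- apply/integrableP; split; first exact: msq.
  apply: le_lt_trans ff; rewrite le_eqVlt; apply/orP; left; apply/eqP.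
  by apply: eq_integral => x _ /=; rewrite ger0_norm ?sqr_ge0.
- move=> n x _; have := le_approx n f0' (I : setT x).
  rewrite /= lee_fin -nnsfun_approxE => fnf.
  have fn0 : 0 <= f_ n x by [].
  rewrite lerXn2r// ?nnegrE ?subr_ge0//; rewrite lerBlDr lerDl.
  exact: fn0.
Qed.

Lemma approximable_opp f : approximable f -> approximable (\- f).
Proof.
move=> [mf fa]; split=> [|e e0]; first exact: measurableT_comp.
have [h Ph fh] := fa _ e0; exists (cst (-1) \* h); first exact: P_mul.
apply: le_lt_trans fh; rewrite le_eqVlt; apply/orP; left; apply/eqP.
by apply: eq_integral => x _ /=; congr (_%:E); ring.
Qed.

Theorem approximable_sqint f : measurable_fun setT f -> (sqint f < +oo)%E ->
  approximable f.
Proof.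
move=> mf ff.
have part g : measurable_fun setT g -> (forall x, g x ^+ 2 = f x ^+ 2) ->
    approximable (fun x => Num.max (g x) 0).
  move=> mg gf; have mg0 : measurable_fun setT (fun x => Num.max (g x) 0).
    exact: measurable_maxr.
  apply: approximable_ge0 => // [x|]; first by rewrite le_max lexx orbT.
  apply: le_lt_trans ff; apply: ge0_le_integral => //; rewrite ?lee_fin//.
  - by move=> x _; rewrite lee_fin sqr_ge0.
  - exact: msq.
  - exact: msq.
  - move=> x _; rewrite lee_fin -gf; case: (leP (g x) 0) => // _.
    by rewrite expr0n sqr_ge0.
have -> : f = (fun x => Num.max (f x) 0) \+ (\- (fun x => Num.max (- f x) 0)).
  apply/funext => x /=.
  by case: (leP (f x) 0) => fx; case: (leP (- f x) 0) => fx' /=; lra.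
apply: approximable_add; first exact: part.
apply: approximable_opp; apply: part => [|x]; last by rewrite sqrrN.
exact: measurableT_comp.
Qed.

End L2Approximation.

(** * Real polynomials on the group *)

Section PolynomialFunctions.
Context (R : realType) (G : carnot R).
Local Notation cpoly := (mpoly (gdim G) R[i]).
Local Notation V := 'rV[R]_(gdim G).
Implicit Types (p q : cpoly) (x : V) (f g h : V -> R).

(** Polynomials act on real points through complex coefficients; these are the real
    functions among them, and they form the algebra used in the approximation. *)
Definition polyfun : set (V -> R) :=
  [set h | exists p : cpoly, forall x, peval p x = (h x)%:C%C].

Lemma polyfun_cst c : polyfun (cst c).
Proof. by exists (mpolyC _ c%:C%C) => x; rewrite /peval mevalC. Qed.

Lemma polyfun_coord i : polyfun (fun x => x ord0 i).
Proof. by exists (mpolyX _ (mnm1 i)) => x; rewrite /peval mevalXU. Qed.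

Lemma polyfun_add g h : polyfun g -> polyfun h -> polyfun (g \+ h).
Proof.
by move=> [p pg] [q qh]; exists (p + q) => x; rewrite pevalD pg qh rmorphD.
Qed.

Lemma polyfun_mul g h : polyfun g -> polyfun h -> polyfun (g \* h).
Proof.
by move=> [p pg] [q qh]; exists (p * q) => x; rewrite pevalM pg qh rmorphM.
Qed.

Lemma peval_real_monomials p x : peval p x =
  \sum_(m <- msupp p) mcoeff m p * (\prod_i x ord0 i ^+ m i)%:C%C.
Proof.
rewrite /peval mevalE; apply: eq_bigr => m _; congr (_ * _).
by rewrite rmorph_prod; apply: eq_bigr => i _; rewrite rmorphXn.
Qed.

Lemma continuous_monomial (m : multinom (gdim G)) :
  continuous (fun x : V => \prod_i x ord0 i ^+ m i).
Proof.
move=> x; elim: (index_enum _) => [|i s IH].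
  under eq_fun do rewrite big_nil; exact: cst_continuous.
under eq_fun do rewrite big_cons.
apply: (@continuousM R V (fun y => y ord0 i ^+ m i)); last exact: IH.
apply: (@continuous_comp _ _ _ (fun y : V => y ord0 i) (fun t : R => t ^+ m i)).
  exact: coord_continuous.
exact: exprn_continuous.
Qed.

Lemma Re_mul_real (z : R[i]) (t : R) : complex.Re (z * t%:C%C) = complex.Re z * t.
Proof. by case: z => a b /=; rewrite mulr0 subr0. Qed.

Lemma Im_mul_real (z : R[i]) (t : R) : complex.Im (z * t%:C%C) = complex.Im z * t.
Proof. by case: z => a b /=; rewrite mulr0 add0r. Qed.

Lemma Re_real_mul (t : R) (z : R[i]) : complex.Re (t%:C%C * z) = t * complex.Re z.
Proof. by rewrite mulrC Re_mul_real mulrC. Qed.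

Lemma Im_real_mul (t : R) (z : R[i]) : complex.Im (t%:C%C * z) = t * complex.Im z.
Proof. by rewrite mulrC Im_mul_real mulrC. Qed.

Lemma continuous_sum_monomials (c : multinom (gdim G) -> R) s :
  continuous (fun x : V => \sum_(m <- s) c m * \prod_i x ord0 i ^+ m i).
Proof.
move=> x; elim: s => [|m s IH].
  under eq_fun do rewrite big_nil; exact: cst_continuous.
under eq_fun do rewrite big_cons.
apply: (@continuousD _ _ V (fun y => c m * \prod_i y ord0 i ^+ m i)); last exact: IH.
apply: (@continuousM R V (cst (c m))); first exact: cst_continuous.
exact: continuous_monomial.
Qed.

Lemma continuous_Re_peval p : continuous (fun x => complex.Re (peval p x)).
Proof.
have -> : (fun x => complex.Re (peval p x)) = fun x =>
    \sum_(m <- msupp p) complex.Re (mcoeff m p) * \prod_i x ord0 i ^+ m i.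
  apply/funext => x; rewrite peval_real_monomials raddf_sum.
  by apply: eq_bigr => m _; rewrite /= Re_mul_real.
exact: continuous_sum_monomials.
Qed.

Lemma continuous_Im_peval p : continuous (fun x => complex.Im (peval p x)).
Proof.
have -> : (fun x => complex.Im (peval p x)) = fun x =>
    \sum_(m <- msupp p) complex.Im (mcoeff m p) * \prod_i x ord0 i ^+ m i.
  apply/funext => x; rewrite peval_real_monomials raddf_sum.
  by apply: eq_bigr => m _; rewrite /= Im_mul_real.
exact: continuous_sum_monomials.
Qed.

Lemma polyfun_continuous h : polyfun h -> continuous h.
Proof.
move=> [p ph]; suff -> : h = fun x => complex.Re (peval p x).
  exact: continuous_Re_peval.
by apply/funext => x; rewrite ph.
Qed.

Lemma borel_open (A : set V) : open A -> measurable (A : set (borelG G)).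
Proof. by move=> oA; exact: sub_sigma_algebra. Qed.

Lemma borel_closed (A : set V) : closed A -> measurable (A : set (borelG G)).
Proof.
by move=> cA; rewrite -[A]setCK; apply: measurableC; apply: borel_open; exact: closed_openC.
Qed.

Lemma continuous_borel f : continuous f -> measurable_fun setT (f : borelG G -> R).
Proof.
move=> /continuousP cf; apply: (measurability _ (RGenOpens.measurableE R)).
move=> _ [_ [a [b ->] <-]]; rewrite setTI; apply: borel_open.
exact/cf/interval_open.
Qed.

Lemma continuous_compact_bounded (K : set V) f : continuous f -> compact K ->
  exists M : R, forall x, K x -> `|f x| <= M.
Proof.
move=> cf cK; have /compact_bounded : compact (f @` K).
  by apply: continuous_compact => //; exact: continuous_subspaceT.
move=> [M [_ /(_ (M + 1))]]; rewrite ltrDl ltr01 => /(_ isT) fM.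
by exists (M + 1) => x Kx; apply: fM; exists x.
Qed.

(** An open set is the countable union of the boxes with rational centre and radius
    1 / (k + 1) that it contains, and a box is a finite intersection of slabs
    {r ^ 2 - (x_i - a) ^ 2 > 0}. *)
Lemma polyfun_generates_borel (S : set (set (borelG G))) : sigma_algebra setT S ->
  (forall g, polyfun g -> S [set x | 0 < g x]) -> forall A, measurable A -> S A.
Proof.
move=> SS Sg A mA; suff oS : open `<=` S by exact: mA.
have /sigma_algebraP[//|ST _ _ SI] := SS.
have [S0 _ SU] := SS.
pose slab i (a : rat) (k : nat) : set V :=
  [set x | 0 < (k.+1%:R^-1) ^+ 2 - (x ord0 i - ratr a) ^+ 2].
have S_slab i a k : S (slab i a k).
  apply: Sg; pose c := fun x : V => x ord0 i - ratr a : R.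
  have pc : polyfun c.
    by apply: polyfun_add (polyfun_coord i) (polyfun_cst (- ratr a)).
  have := polyfun_add (polyfun_cst (k.+1%:R^-1 ^+ 2))
    (polyfun_mul (polyfun_cst (-1)) (polyfun_mul pc pc)).
  by congr polyfun; apply/funext => x /=; rewrite mulN1r expr2.
pose box (a : {ffun 'I_(gdim G) -> rat}) k := \big[setI/setT]_i slab i (a i) k.
have S_box a k : S (box a k).
  by rewrite /box; elim/big_ind : _ => // B C SB SC; exact: SI.
have boxP a k x : box a k x <-> forall i, `|x ord0 i - ratr (a i)| < k.+1%:R^-1.
  rewrite /box -bigcap_seq; split=> [xb i|xi i _ /=].
    have := xb i (mem_index_enum i).
    by rewrite /slab /= subr_gt0 -[ltLHS]real_normK ?num_real// ltr_pXn2r ?nnegrE ?invr_ge0//.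
  by rewrite /slab /= subr_gt0 -[ltLHS]real_normK ?num_real// ltr_pXn2r ?nnegrE ?invr_ge0//.
move=> U oU.
pose I := ({ffun 'I_(gdim G) -> rat} * nat)%type.
(* the boxes contained in U, enumerated through the countability of I *)
pose B (j : nat) : set V := if @choice.unpickle I j is Some c then
  (if `[< box c.1 c.2 `<=` U >] then box c.1 c.2 else set0) else set0.
suff -> : U = \bigcup_j B j.
  by apply: SU => j; rewrite /B; case: choice.unpickle => // -[a k]; case: ifP.
apply/seteqP; split=> x; last first.
  move=> [j _]; rewrite /B; case: choice.unpickle => // -[a k].
  by case: asboolP => // bU /bU.
move=> Ux; have /nbhs_ballP[e /= e0 eU] := open_nbhs_nbhs (conj oU Ux).
(* a factor 2: x and y are both within 1 / (k + 1) of the rational centre *)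
have [k ke] : exists k : nat, 2 * k.+1%:R^-1 < e.
  have [k] := ltr_add_invr (divr_gt0 e0 (ltr0Sn R 1)).
  by rewrite add0r => ke; exists k; rewrite mulrC -ltr_pdivlMr.
have [a xa] : exists a : {ffun 'I_(gdim G) -> rat},
    forall i, `|x ord0 i - ratr (a i)| < k.+1%:R^-1.
  have /choice[a ai] i : exists q : rat, `|x ord0 i - ratr q| < k.+1%:R^-1.
    have [|q] := @rat_in_itvoo R (x ord0 i - k.+1%:R^-1) (x ord0 i + k.+1%:R^-1).
      by rewrite ltrD2l gtrN.
    rewrite in_itv /= => /andP[h1 h2]; exists q; rewrite ltr_norml.
    move: h1 h2; move: (k.+1%:R^-1) (ratr q) (x ord0 i) => u v w h1 h2.
    by apply/andP; split; lra.
  by exists [ffun i => a i] => i; rewrite ffunE.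
exists (choice.pickle ((a, k) : I)) => //; rewrite /B choice.pickleK.
case: asboolP => [_|[] y /boxP ya /=]; first exact/boxP.
apply: eU; split=> // i j; rewrite (ord1 i) /ball /=.
have -> : x ord0 j - y ord0 j = (x ord0 j - ratr (a j)) - (y ord0 j - ratr (a j)).
  by rewrite opprB addrA subrK.
apply: le_lt_trans (ler_normB _ _) _; apply: lt_trans ke.
by rewrite mulr_natl mulr2n ltrD.
Qed.

End PolynomialFunctions.

(** * The support of the measure of the sphere *)

Section SphereMeasure.
Context (R : realType) (G : carnot R) (N : 'rV[R]_(gdim G) -> R).
Hypothesis hN : is_gauge N.
Local Notation cpoly := (mpoly (gdim G) R[i]).
Local Notation V := 'rV[R]_(gdim G).

Lemma gauge_continuous : continuous N. Proof. by case: hN. Qed.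

Lemma sphere_compact : compact (sphere N).
Proof.
case: hN => _ Nproper _ _.
by rewrite (_ : sphere N = N @^-1` [set 1])//; apply: Nproper; exact: compact_set1.
Qed.

Lemma sphere_measurable : measurable (sphere N : set (borelG G)).
Proof.
by apply: borel_closed; apply: compact_closed sphere_compact; exact: norm_hausdorff.
Qed.

Context (mu : {measure set (borelG G) -> \bar R}) (hmu : is_haar mu).
Context (sigma : {finite_measure set (borelG G) -> \bar R}).
Hypothesis hsigma : is_sphere_measure mu N sigma.

(** Twice the positive part of (t - 1/2) (2 - t). *)
Definition annular_bump (t : R) : R :=
  (t - 2^-1) * (2 - t) + `|(t - 2^-1) * (2 - t)|.

Lemma annular_bump_continuous : continuous annular_bump.
Proof.
have h (t : R) : (s - 2^-1 : R) * (2 - s) @[s --> t] --> (t - 2^-1) * (2 - t).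
  by apply: cvgM; apply: cvgB; [exact: cvg_id|exact: cvg_cst|exact: cvg_cst|exact: cvg_id].
by move=> t; apply: cvgD; [exact: h|apply: cvg_norm; exact: h].
Qed.

Lemma annular_bump_ge0 t : 0 <= annular_bump t.
Proof.
by rewrite /annular_bump; set g := _ * _; have := ler_norm (- g); rewrite normrN; lra.
Qed.

Lemma annular_bump1 : 0 < annular_bump 1.
Proof. by rewrite /annular_bump gtr0_norm ?mulr_gt0//; lra. Qed.

Lemma annular_bump_supp t : annular_bump t != 0 -> 2^-1 <= t <= 2.
Proof.
rewrite /annular_bump; apply: contraR; rewrite negb_and -!ltNge => h.
rewrite ler0_norm ?subrr//; case/orP: h => h.
  by rewrite mulr_le0_ge0//; lra.
by rewrite mulr_ge0_le0//; lra.
Qed.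

Lemma continuous_sum_sqr (f g : V -> R) : continuous f -> continuous g ->
  continuous (fun x => f x ^+ 2 + g x ^+ 2).
Proof.
have sqr (h : V -> R) : continuous h -> continuous (fun x => h x ^+ 2).
  move=> ch x; apply: (@continuous_comp _ _ _ h (fun t : R => t ^+ 2)); first exact: ch.
  exact: exprn_continuous.
move=> cf cg x.
by apply: (@continuousD _ _ V (fun x => f x ^+ 2)); [exact: (sqr f)|exact: (sqr g)].
Qed.

Lemma continuous_gauge_comb k (g : nat -> V -> R) : (forall j, continuous (g j)) ->
  continuous (fun x => \sum_(j < k.+1) N x ^+ (k - j) * g j x).
Proof.
move=> cg x; elim: (index_enum _) => [|j s IH].
  under eq_fun do rewrite big_nil; exact: cst_continuous.
under eq_fun do rewrite big_cons.
apply: (@continuousD _ _ V (fun y => N y ^+ (k - j) * g j y)); last exact: IH.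
apply: (@continuousM R V (fun y => N y ^+ (k - j))); last exact: cg.
apply: (@continuous_comp _ _ _ N (fun t : R => t ^+ (k - j))).
  exact: gauge_continuous.
exact: exprn_continuous.
Qed.

(** Below, A + i B is the function F x = sum_j N x ^ (k - j) * q_j x, for which
    F (dil r x) = r ^ k * p x on the sphere. It replaces p (dil (N x)^-1 x), whose
    continuity would have to be proved away from the origin. *)
Lemma sphere_measure_full_support (k : nat) (p : cpoly) : polyA G k p ->
  {ae sigma, forall x, sphere N x -> peval p x = 0} ->
  forall x, sphere N x -> peval p x = 0.
Proof.
case: hN => cN Nproper [N0 Npos] Nhom.
move=> [q [qP pE]] p0 x0 Sx0; apply: contrapT => px0.
pose A x := \sum_(j < k.+1) N x ^+ (k - j) * complex.Re (peval (q j) x).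
pose B x := \sum_(j < k.+1) N x ^+ (k - j) * complex.Im (peval (q j) x).
pose f x := annular_bump (N x) * (A x ^+ 2 + B x ^+ 2).
pose P x := complex.Re (peval p x) ^+ 2 + complex.Im (peval p x) ^+ 2.
have P0 x : 0 <= P x by rewrite addr_ge0 ?sqr_ge0.
have f0 x : 0 <= f x by rewrite mulr_ge0 ?annular_bump_ge0 ?addr_ge0 ?sqr_ge0.
have cP : continuous P.
  apply: continuous_sum_sqr; [exact: continuous_Re_peval|exact: continuous_Im_peval].
have cf : continuous f.
  have cA : continuous A.
    exact: (@continuous_gauge_comb k (fun j x => complex.Re (peval (q j) x))
      (fun j => @continuous_Re_peval R G (q j))).
  have cB : continuous B.
    exact: (@continuous_gauge_comb k (fun j x => complex.Im (peval (q j) x))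
      (fun j => @continuous_Im_peval R G (q j))).
  move=> x; apply: (@continuousM R V (fun x => annular_bump (N x))).
    by apply: (@continuous_comp _ _ _ N annular_bump); [exact: cN|exact: annular_bump_continuous].
  exact: (continuous_sum_sqr cA cB).
have f_dil r x : 0 < r -> sphere N x -> f (dil r x) = annular_bump r * r ^+ (k + k) * P x.
  move=> r0 Sx; have Nx : N (dil r x) = r by rewrite Nhom// Sx mulr1.
  have re (j : 'I_k.+1) : r ^+ (k - j) * r ^+ j = r ^+ k.
    by rewrite -exprD subnK// -ltnS.
  have AE : A (dil r x) = r ^+ k * complex.Re (peval p x).
    rewrite /A pE peval_sum raddf_sum mulr_sumr; apply: eq_bigr => j _.
    by rewrite Nx qP// Re_real_mul mulrA re.
  have BE : B (dil r x) = r ^+ k * complex.Im (peval p x).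
    rewrite /B pE peval_sum raddf_sum mulr_sumr; apply: eq_bigr => j _.
    by rewrite Nx qP// Im_real_mul mulrA re.
  rewrite /f AE BE Nx /P exprD; ring.
have ccf : Cc_punctured f.
  have sub : closure [set x | f x != 0] `<=` N @^-1` [set` `[2^-1, 2]].
    rewrite closureE => x; apply; split.
      apply: preimage_closed; last exact: itv_closed.
      by move=> y _; exact: cN.
    move=> y /=; rewrite /f mulf_eq0 negb_or => /andP[/annular_bump_supp + _].
    by rewrite in_itv.
  split=> //.
    apply: subclosed_compact sub; first exact: closed_closure.
    by apply: Nproper; exact: segment_compact.
  by move=> /sub; rewrite /= in_itv /= N0; lra.
have [sigmaS /(_ f ccf) hf] := hsigma.
have mf := continuous_borel cf; have mP := continuous_borel cP.
have inner0 r : 0 < r -> (\int[sigma]_(x in sphere N) (f (dil r x))%:E = 0)%E.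
  move=> r0.
  transitivity (\int[sigma]_(x in sphere N) (annular_bump r * r ^+ (k + k) * P x)%:E)%E.
    by apply: eq_integral => x; rewrite inE => Sx; rewrite f_dil.
  rewrite (ae_eq_integral (cst 0%E)) ?integral0//.
  - exact: sphere_measurable.
  - by apply/measurable_EFinP; apply: measurable_funTS; apply: measurable_funM.
  - apply: (filterS (Filter := ae_filter_ringOfSetsType sigma)) p0 => x px Sx.
    by rewrite /P px//= expr0n addr0 mulr0.
have int0 : (\int[mu]_x (f x)%:E = 0)%E.
  rewrite hf; apply: integral0_eq => r; rewrite /= in_itv /= andbT => r0.
  by rewrite inner0// mul0e.
pose U := [set x | f x != 0].
have oU : open U.
  apply: (@open_comp _ _ f [set t | t != 0]); first by move=> x _; exact: cf.
  exact: open_neq.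
have [_ _ /(_ U oU)] := hmu.
suff -> : mu U = 0%E.
  move=> U0; suff : (0 < 0 :> \bar R)%E by rewrite ltxx.
  apply: U0; exists x0; rewrite /U /=.
  have -> : f x0 = annular_bump 1 * P x0.
    have dil1 : dil 1 x0 = x0 by apply/rowP => i; rewrite mxE expr1n mul1r.
    by rewrite -{1}dil1 f_dil// expr1n mulr1.
  apply: mulf_neq0; first by rewrite gt_eqF ?annular_bump1.
  rewrite /P paddr_eq0 ?sqr_ge0//.
  apply/negP => /andP[]; rewrite !sqrf_eq0 => /eqP re0 /eqP im0.
  by apply: px0; case: (peval p x0) re0 im0 => a b /= -> ->.
have mEf : measurable_fun setT (EFin \o f : borelG G -> \bar R) by exact/measurable_EFinP.
have /(ae_eq_integral_abs mu measurableT mEf) : (\int[mu]_x `|(EFin \o f) x| = 0)%E.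
  by rewrite -[RHS]int0; apply: eq_integral => x _ /=; rewrite ger0_norm.
move=> [Z [mZ Z0 UZ]]; apply: (subset_measure0 _ mZ _ Z0); first exact: borel_open.
move=> x /eqP fx; apply: UZ => /= fx0.
by apply: fx; have [] := fx0 I.
Qed.

End SphereMeasure.

(** * The complex space of square integrable functions *)

Section ComplexIntegral.
Context d (T : measurableType d) (R : realType) (mu : {measure set T -> \bar R}).
Implicit Types F : T -> R[i].

Definition cintegrable F :=
  mu.-integrable setT (EFin \o (@complex.Re R \o F)) /\
  mu.-integrable setT (EFin \o (@complex.Im R \o F)).

(** The inner product of L^2 is [cintegral] of u times the conjugate of v. *)
Definition cintegral F : R[i] :=
  Complex (\int[mu]_x complex.Re (F x)) (\int[mu]_x complex.Im (F x)).

Lemma Re_mul (z w : R[i]) : complex.Re (z * w) =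
  complex.Re z * complex.Re w - complex.Im z * complex.Im w.
Proof. by case: z; case: w. Qed.

Lemma Im_mul (z w : R[i]) : complex.Im (z * w) =
  complex.Re z * complex.Im w + complex.Im z * complex.Re w.
Proof. by case: z; case: w. Qed.

Lemma Re_lin a b (z w : R[i]) : complex.Re ((a +i* b)%C * z + w) =
  a * complex.Re z + (- b * complex.Im z + complex.Re w).
Proof. by rewrite raddfD /= Re_mul /= -addrA mulNr. Qed.

Lemma Im_lin a b (z w : R[i]) : complex.Im ((a +i* b)%C * z + w) =
  a * complex.Im z + (b * complex.Re z + complex.Im w).
Proof. by rewrite raddfD /= Im_mul /= -addrA. Qed.

Lemma integrable_lin (a : R) (f g : T -> R) :
  mu.-integrable setT (EFin \o f) -> mu.-integrable setT (EFin \o g) ->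
  mu.-integrable setT (EFin \o (fun x => a * f x + g x)).
Proof.
move=> fi gi; rewrite (_ : _ \o _ = (fun x => a%:E * (EFin \o f) x) \+ (EFin \o g))%E//.
by apply: integrableD => //; exact: integrableZl.
Qed.

Lemma Rintegral_lin (a : R) (f g : T -> R) :
  mu.-integrable setT (EFin \o f) -> mu.-integrable setT (EFin \o g) ->
  \int[mu]_x (a * f x + g x) = a * \int[mu]_x f x + \int[mu]_x g x.
Proof.
move=> fi gi; rewrite RintegralD ?RintegralZl//.
rewrite (_ : _ \o _ = (fun x => a%:E * (EFin \o f) x))%E//.
exact: integrableZl.
Qed.

Lemma cintegral_lin a F H : cintegrable F -> cintegrable H ->
  cintegral (fun x => a * F x + H x) = a * cintegral F + cintegral H.
Proof.
move=> [Fr Fi] [Hr Hi]; case: a => a b; rewrite /cintegral.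
have i1 := integrable_lin (- b) Fi Hr; have i2 := integrable_lin b Fr Hi.
have -> : \int[mu]_x complex.Re ((a +i* b)%C * F x + H x) =
    \int[mu]_x (a * complex.Re (F x) + (- b * complex.Im (F x) + complex.Re (H x))).
  by apply: eq_Rintegral => x _; rewrite Re_lin.
have -> : \int[mu]_x complex.Im ((a +i* b)%C * F x + H x) =
    \int[mu]_x (a * complex.Im (F x) + (b * complex.Re (F x) + complex.Im (H x))).
  by apply: eq_Rintegral => x _; rewrite Im_lin.
rewrite (Rintegral_lin a Fr i1) (Rintegral_lin _ Fi Hr).
rewrite (Rintegral_lin a Fi i2) (Rintegral_lin _ Fr Hi).
by apply/eqP; rewrite eq_complex /= !addrA mulNr !eqxx.
Qed.

Lemma cintegral_conj F : cintegrable F ->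
  cintegral (fun x => conjc (F x)) = conjc (cintegral F).
Proof.
move=> [_ Fi]; rewrite /cintegral /=; congr Complex.
  by apply: eq_Rintegral => x _; case: (F x).
rewrite -[RHS]mulN1r -RintegralZl//; apply: eq_Rintegral => x _.
by case: (F x) => u v /=; rewrite mulN1r.
Qed.

Lemma cintegral_ae F H : cintegrable F -> cintegrable H ->
  {ae mu, forall x, F x = H x} -> cintegral F = cintegral H.
Proof.
move=> [/measurable_int Fr /measurable_int Fi] [/measurable_int Hr /measurable_int Hi] FH.
by rewrite /cintegral /Rintegral; congr (Complex (fine _) (fine _));
  apply: ae_eq_integral => //; apply: filterS FH => x /= ->.
Qed.

End ComplexIntegral.

Section L2Space.
Local Open Scope quotient_scope.
Context d (T : measurableType d) (R : realType) (mu : {measure set T -> \bar R}).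
Implicit Types (u v w : L2 mu) (f g : T -> R).

Lemma L2rep_pi (f : L2fun mu) : {ae mu, forall x, L2rep (\pi_(L2 mu) f) x = f x}.
Proof.
have /eqmodP := reprK (\pi_(L2 mu) f : L2 mu).
rewrite /= Quotient.equivE => /asboolP; apply: filterS => x.
by rewrite /= !fctE => /eqP; rewrite subr_eq0 => /eqP.
Qed.

Lemma L2rep_inj u v : {ae mu, forall x, u x = v x} -> u = v.
Proof.
move=> uv; rewrite -[u]reprK -[v]reprK; apply/eqmodP.
rewrite /= Quotient.equivE; apply/asboolP; apply: filterS uv => x uv.
by rewrite /= !fctE; apply/eqP; rewrite subr_eq0; apply/eqP.
Qed.

Lemma L2pi_unique u (f : L2fun mu) : {ae mu, forall x, u x = f x} -> u = \pi_(L2 mu) f.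
Proof.
by move=> uf; apply: L2rep_inj; apply: filterS2 uf (L2rep_pi f) => x -> ->.
Qed.

Lemma L2pi0 : \pi_(L2 mu) 0 = 0.
Proof.
by rewrite -(scale0r (0 : L2fun mu)) -pi_L2scale -[RHS](scale0r (\pi_(L2 mu) 0)).
Qed.

Lemma L2pi_eq0 (f : L2fun mu) : \pi_(L2 mu) f = 0 <-> {ae mu, forall x, f x = 0}.
Proof.
split=> [f0|f0].
  have := L2rep_pi f; rewrite f0 -L2pi0 => h.
  by apply: filterS2 h (L2rep_pi 0) => x <- ->.
rewrite -L2pi0; apply/esym/L2pi_unique.
by apply: filterS2 f0 (L2rep_pi 0) => x -> ->.
Qed.

(** Representatives are chosen in each class, so they are linear only almost
    everywhere. *)
Lemma L2rep_lin a u v : {ae mu, forall x, L2rep (a *: u + v) x = a * u x + v x}.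
Proof.
have -> : a *: u + v = \pi_(L2 mu) (a *: repr u + repr v).
  by rewrite pi_L2D -pi_L2scale !reprK.
exact: L2rep_pi.
Qed.

Lemma L2rep_Re u : (@complex.Re R \o u) \in Lfun mu 2%:E.
Proof. by rewrite /L2rep; case: (repr u) => f /= /andP[]. Qed.

Lemma L2rep_Im u : (@complex.Im R \o u) \in Lfun mu 2%:E.
Proof. by rewrite /L2rep; case: (repr u) => f /= /andP[]. Qed.

Lemma Lfun2_mul_integrable f g : f \in Lfun mu 2%:E -> g \in Lfun mu 2%:E ->
  mu.-integrable setT (EFin \o (fun x => f x * g x)).
Proof. by move=> fL gL; apply/Lfun1_integrable; exact: Lfun2_mul_Lfun1. Qed.

Lemma L2_integrable u v : cintegrable mu (fun x => u x * conjc (v x)).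
Proof.
have rr := Lfun2_mul_integrable (L2rep_Re u) (L2rep_Re v).
have ii := Lfun2_mul_integrable (L2rep_Im u) (L2rep_Im v).
have ri := Lfun2_mul_integrable (L2rep_Re u) (L2rep_Im v).
have ir := Lfun2_mul_integrable (L2rep_Im u) (L2rep_Re v).
split.
  have := integrable_lin 1 rr ii.
  by congr (mu.-integrable setT _); apply/funext => x /=; case: (u x) (v x) => a b [c e] /=;
    rewrite mul1r mulrN opprK.
have := integrable_lin (-1) ri ir.
by congr (mu.-integrable setT _); apply/funext => x /=; case: (u x) (v x) => a b [c e] /=;
  rewrite mulN1r mulrN.
Qed.

Lemma L2ip_lin a u v w : L2ip (a *: u + v) w = a * L2ip u w + L2ip v w.
Proof.
rewrite -[LHS]/(cintegral mu _) -cintegral_lin; [|exact: L2_integrable..].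
apply: cintegral_ae; first exact: L2_integrable.
  have [r1 i1] := L2_integrable u w; have [r2 i2] := L2_integrable v w.
  case: a => a b; split.
    have := integrable_lin a r1 (integrable_lin (- b) i1 r2).
    congr (mu.-integrable setT _); apply/funext => x.
    by congr EFin; rewrite /comp Re_lin.
  have := integrable_lin a i1 (integrable_lin b r1 i2).
  congr (mu.-integrable setT _); apply/funext => x.
  by congr EFin; rewrite /comp Im_lin.
apply: filterS (L2rep_lin a u v) => x ->; by rewrite mulrDl mulrA.
Qed.

Lemma L2ip_conj u v : L2ip v u = conjc (L2ip u v).
Proof.
rewrite -[L2ip u v]/(cintegral mu _) -cintegral_conj; last exact: L2_integrable.
rewrite -[LHS]/(cintegral mu _); congr (cintegral mu _); apply/funext => x.
by case: (u x) (v x) => a b [c e] /=; congr Complex; ring.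
Qed.

Lemma Re_mul_conj (z : R[i]) : complex.Re (z * conjc z) =
  complex.Re z ^+ 2 + complex.Im z ^+ 2.
Proof. by case: z => a b /=; rewrite mulrN opprK !expr2. Qed.

Lemma L2ip_ge0 u : 0 <= complex.Re (L2ip u u).
Proof.
by apply: Rintegral_ge0 => x _; rewrite Re_mul_conj addr_ge0 ?sqr_ge0.
Qed.

Lemma L2ip_eq0 u : complex.Re (L2ip u u) = 0 -> u = 0.
Proof.
move=> /= u0; have [uI _] := L2_integrable u u.
pose g := @complex.Re R \o (fun x => u x * conjc (u x)).
have : (\int[mu]_x `|(EFin \o g) x| = 0)%E.
  rewrite -[RHS]/(0%:E) -u0 /Rintegral fineK; last exact: integrable_fin_num.
  apply: eq_integral => x _ /=.
  by rewrite ger0_norm// /g [X in 0 <= X]Re_mul_conj addr_ge0 ?sqr_ge0.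
move/(ae_eq_integral_abs mu measurableT (measurable_int _ uI)) => ux.
rewrite -L2pi0; apply: L2rep_inj; apply: filterS2 ux (L2rep_pi 0) => x /(_ I)[+] ->.
rewrite Re_mul_conj => /eqP; rewrite paddr_eq0 ?sqr_ge0// !sqrf_eq0 => /andP[/eqP r /eqP i].
by case: (u x) r i => a b /= -> ->.
Qed.

Lemma L2ip_dist u (f : L2fun mu) :
  complex.Re (L2ip (u - \pi_(L2 mu) f) (u - \pi_(L2 mu) f)) =
  \int[mu]_x ((complex.Re (u x) - complex.Re (f x)) ^+ 2 +
              (complex.Im (u x) - complex.Im (f x)) ^+ 2).
Proof.
set w := u - _; have [/measurable_int wI _] := L2_integrable w w.
have mfd : measurable_fun setT (fun x =>
    (complex.Re (u x) - complex.Re (f x)) ^+ 2 +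
    (complex.Im (u x) - complex.Im (f x)) ^+ 2).
  have mLfun (g : T -> R) : g \in Lfun mu 2%:E -> measurable_fun setT g.
    by case/andP => /[!inE].
  have [mr mi] : measurable_fun setT (@complex.Re R \o f) /\
      measurable_fun setT (@complex.Im R \o f).
    by case: (f) => g /= /andP[/mLfun ? /mLfun ?].
  apply: measurable_funD; apply: measurable_funX; apply: measurable_funB => //.
    exact/mLfun/L2rep_Re.
  exact/mLfun/L2rep_Im.
rewrite /L2ip /= /Rintegral; congr fine; apply: ae_eq_integral => //.
  exact/measurable_EFinP.
have wE : w = (-1) *: \pi_(L2 mu) f + u by rewrite scaleN1r addrC.
rewrite wE; apply: filterS2 (L2rep_lin (-1) (\pi_(L2 mu) f) u) (L2rep_pi f).
move=> x -> -> _; congr EFin; rewrite Re_mul_conj mulN1r.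
by case: (u x) (f x) => a b [c e] /=; ring.
Qed.

Lemma Lfun2P f : measurable_fun setT f -> (\int[mu]_x ((f x) ^+ 2)%:E < +oo)%E ->
  f \in Lfun mu 2%:E.
Proof.
move=> mf ff; apply/andP; split; rewrite inE//=; rewrite /finite_norm unlock.
apply: poweR_lty; apply: le_lt_trans ff; rewrite le_eqVlt; apply/orP; left; apply/eqP.
by apply: eq_integral => x _ /=; rewrite powR_mulrn ?normr_ge0// real_normK ?num_real.
Qed.

End L2Space.

(** * Traces of polynomials on the sphere *)

Section Traces.
Context (R : realType) (G : carnot R) (N : 'rV[R]_(gdim G) -> R).
Hypothesis hN : is_gauge N.
Context (mu : {measure set (borelG G) -> \bar R}) (hmu : is_haar mu).
Context (sigma : {finite_measure set (borelG G) -> \bar R}).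
Hypothesis hsigma : is_sphere_measure mu N sigma.
Local Open Scope quotient_scope.
Local Notation cpoly := (mpoly (gdim G) R[i]).
Local Notation V := 'rV[R]_(gdim G).
Implicit Types (p q : cpoly) (u : L2 sigma).

Lemma integral_sphere (f : borelG G -> \bar R) : measurable_fun setT f ->
  (forall x, 0 <= f x)%E -> (\int[sigma]_x f x = \int[sigma]_(x in sphere N) f x)%E.
Proof.
move=> mf f0; have mS := sphere_measurable hN; have [sS _] := hsigma.
rewrite (ge0_negligible_integral (measurableC mS))//.
by rewrite setTD setCK.
Qed.

(** The complement of the sphere is a null set, so the restriction of a condition
    to the sphere is invisible to sigma. *)
Lemma ae_sphere (A : V -> Prop) :
  {ae sigma, forall x, sphere N x -> A x} <-> {ae sigma, forall x, A x}.
Proof.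
have aeS : Filter (almost_everywhere sigma) := ae_filter_ringOfSetsType sigma.
split; last by move=> h; apply: filterS h => x Ax _.
have [sS _] := hsigma; have mS := sphere_measurable hN.
have inS : {ae sigma, forall x, sphere N x}.
  by exists (~` sphere N); split=> //; exact: measurableC.
by apply: filterS2 inS => x Sx; apply.
Qed.

Lemma continuous_Lfun2 (f : V -> R) : continuous f ->
  (f : borelG G -> R) \in Lfun sigma 2%:E.
Proof.
move=> cf; have mf := continuous_borel cf; have mS := sphere_measurable hN.
have [M fM] := continuous_compact_bounded cf (sphere_compact hN).
apply: Lfun2P => //.
rewrite integral_sphere; first last.
- by move=> x; rewrite lee_fin sqr_ge0.
- by apply/measurable_EFinP; exact: measurable_funX.
apply: (@le_lt_trans _ _ (\int[sigma]_(x in sphere N) (M ^+ 2)%:E)%E).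
  apply: ge0_le_integral => //.
  - by move=> x _; rewrite lee_fin sqr_ge0.
  - by apply/measurable_EFinP; apply: measurable_funTS; exact: measurable_funX.
  - move=> x Sx; rewrite lee_fin -[leLHS]real_normK ?num_real//.
    by rewrite lerXn2r// ?nnegrE// ?fM// (le_trans _ (fM _ Sx)).
rewrite integral_cst//; rewrite -[X in (_ * X)%E]fineK -?EFinM ?ltry//.
exact: fin_num_measure.
Qed.

Lemma peval_L2pred p : (peval p : borelG G -> R[i]) \in L2pred sigma.
Proof.
apply/andP; split; apply: continuous_Lfun2.
  exact: continuous_Re_peval.
exact: continuous_Im_peval.
Qed.

(** A polynomial is bounded on the sphere, which carries sigma, so it has a class
    in L^2 without being restricted; this makes [trace] linear on the nose. *)
Definition trace p : L2 sigma := \pi_(L2 sigma) (L2Fun (peval_L2pred p)).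

Lemma trace_lin a p q : trace (a *: p + q) = a *: trace p + trace q.
Proof.
rewrite /trace; have -> b (f : L2fun sigma) : b *: \pi_(L2 sigma) f = \pi_(L2 sigma) (b *: f).
  exact: pi_L2scale.
rewrite -pi_L2D; congr (\pi_(L2 sigma) _).
by apply: val_inj; apply/funext => x; rewrite /= !fctE pevalD pevalZ.
Qed.

Lemma trace0 : trace 0 = 0.
Proof. by have := trace_lin (-1) 0 0; rewrite scaler0 addr0 scaleN1r addNr. Qed.

Lemma traceVE (m : int) : traceV N sigma m = trace @` polyA G m.
Proof.
apply/seteqP; split=> [u [p Ap /ae_sphere up]|_ [p Ap <-]].
  by exists p => //; apply/esym/L2pi_unique.
by exists p => //; apply/ae_sphere; exact: L2rep_pi.
Qed.

Lemma trace_eq0 (k : nat) p : polyA G k p ->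
  trace p = 0 <-> vanishing_ideal N p.
Proof.
move=> Ap; split=> [/L2pi_eq0 p0|p0].
  by apply: (sphere_measure_full_support hN hmu hsigma Ap); apply/ae_sphere.
by apply/L2pi_eq0/ae_sphere; apply: aeW => x Sx; exact: p0.
Qed.

Lemma traceV_has_dim (m : int) : exists d, has_dim (traceV N sigma m) d.
Proof.
have [d Ad] := polyA_has_dim G m; rewrite traceVE.
by have [_ [r [_ Vr _]]] := rank_nullity trace_lin Ad; exists r.
Qed.

Lemma intS_sub1 (n : nat) : n.+1%:Z - 1 = n%:Z.
Proof. by rewrite intS addrC addKr. Qed.

Lemma traceV_mono (n : nat) : traceV N sigma (n%:Z - 1) `<=` traceV N sigma n%:Z.
Proof.
rewrite !traceVE; case: n => [|n].
  move=> _ [p -> <-]; exists 0 => //; exact: (polyA_subspace G 0%N).1.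
by rewrite intS_sub1 => _ [p Ap <-]; exists p => //; exact: polyA_mono Ap.
Qed.

(** Approximate the real and imaginary parts of u by real polynomials h1 and h2;
    then h1 + i h2 belongs to some A_k, by [polyA_exhaust]. *)
Lemma traceV_dense u (e : R) : 0 < e -> exists n v,
  traceV N sigma (n%:Z - 1) v /\ complex.Re (L2ip (u - v) (u - v)) < e.
Proof.
move=> e0; have mS := sphere_measurable hN.
have approx f : f \in Lfun sigma 2%:E -> approximable sigma (sphere N) (@polyfun R G) f.
  move=> fL; have mf : measurable_fun setT f by case/andP: fL => /[!inE].
  apply: approximable_sqint (mf) _ => //.
  - exact: polyfun_cst.
  - exact: polyfun_add.
  - exact: polyfun_mul.
  - by move=> h /polyfun_continuous; exact: continuous_borel.
  - move=> h /polyfun_continuous ch.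
    exact: continuous_compact_bounded (sphere_compact hN).
  - exact: polyfun_generates_borel.
  - rewrite /sqint -integral_sphere; first last.
    + by move=> x; rewrite lee_fin sqr_ge0.
    + by apply/measurable_EFinP; exact: measurable_funX.
    have /integrableP[_] := Lfun2_integrable_sqr fL.
    apply: le_lt_trans; rewrite le_eqVlt; apply/orP; left; apply/eqP.
    by apply: eq_integral => x _ /=; rewrite ger0_norm ?sqr_ge0.
have e20 : 0 < e / 2 by rewrite divr_gt0.
have [mr /(_ _ e20)[h1 [p1 p1E] h1e]] := approx _ (L2rep_Re u).
have [mi /(_ _ e20)[h2 [p2 p2E] h2e]] := approx _ (L2rep_Im u).
pose p := p1 + 'i%C *: p2.
have pE x : peval p x = Complex (h1 x) (h2 x).
  rewrite pevalD pevalZ p1E p2E; apply/eqP; rewrite eq_complex /=.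
  by apply/andP; split; apply/eqP; ring.
have [k Ap] := polyA_exhaust p.
exists k.+1, (trace p); split; first by rewrite traceVE intS_sub1; exists p.
have mh1 : measurable_fun setT (h1 : borelG G -> R).
  by apply: continuous_borel; apply: polyfun_continuous; exists p1.
have mh2 : measurable_fun setT (h2 : borelG G -> R).
  by apply: continuous_borel; apply: polyfun_continuous; exists p2.
have mr2 := measurable_funX 2 (measurable_funB mr mh1).
have mi2 := measurable_funX 2 (measurable_funB mi mh2).
rewrite L2ip_dist /Rintegral integral_sphere; first last.
- by move=> x; rewrite lee_fin addr_ge0 ?sqr_ge0.
- apply/measurable_EFinP; under eq_fun do rewrite /= pE /=.
  exact: measurable_funD mr2 mi2.
have -> : (\int[sigma]_(x in sphere N)
    ((complex.Re (u x) - complex.Re (peval p x)) ^+ 2 +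
     (complex.Im (u x) - complex.Im (peval p x)) ^+ 2)%R%:E)%E =
    (sqint sigma (sphere N) ((@complex.Re R \o u) \- h1)%R +
     sqint sigma (sphere N) ((@complex.Im R \o u) \- h2)%R)%E.
  rewrite /sqint -ge0_integralD//.
  - by apply: eq_integral => x _; rewrite pE.
  - by move=> x _; rewrite lee_fin sqr_ge0.
  - by apply/measurable_EFinP; exact: measurable_funTS.
  - by move=> x _; rewrite lee_fin sqr_ge0.
  - by apply/measurable_EFinP; exact: measurable_funTS.
move: h1e h2e (sqint_ge0 sigma (sphere N) ((@complex.Re R \o u) \- h1)%R)
  (sqint_ge0 sigma (sphere N) ((@complex.Im R \o u) \- h2)%R).
case: (sqint _ _ _) => [a| |]//; case: (sqint _ _ _) => [b| |]//=.
rewrite !lte_fin; lra.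
Qed.

End Traces.

Theorem theorem3p4 (R : realType) (G : carnot R)
    (N : 'rV[R]_(gdim G) -> R) (hN : is_gauge N)
    (mu : {measure set (borelG G) -> \bar R}) (hmu : is_haar mu)
    (sigma : {finite_measure set (borelG G) -> \bar R})
    (hsigma : is_sphere_measure mu N sigma) :
  [/\ hilbert_direct_sum (fun m : nat => traceW N sigma m%:Z),
      forall m : nat,
        orth_direct_sum (traceV N sigma (m%:Z - 1)) (traceW N sigma m%:Z)
          (traceV N sigma m%:Z) /\
        exists dW dV dV1 : nat,
          [/\ has_dim (traceW N sigma m%:Z) dW,
              has_dim (traceV N sigma m%:Z) dV,
              has_dim (traceV N sigma (m%:Z - 1)) dV1 &
              dW%:Z = dV%:Z - dV1%:Z]
    & forall m : nat,
        exists dV dA dI : nat,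
          [/\ has_dim (traceV N sigma m%:Z) dV,
              has_dim (polyA G m%:Z) dA,
              has_dim (vanishing_ideal N `&` polyA G m%:Z) dI &
              dV%:Z = dA%:Z - dI%:Z]].
Proof.
have ipL := @L2ip_lin _ _ _ sigma; have ipC := @L2ip_conj _ _ _ sigma.
have ip0 := @L2ip_ge0 _ _ _ sigma; have ipE := @L2ip_eq0 _ _ _ sigma.
(* shifted by one, so that the chain starts from the zero space at 0 *)
pose A (n : nat) := traceV N sigma (n%:Z - 1).
have A0 : A 0%N = [set 0].
  rewrite /A (traceVE hN hsigma); apply/seteqP; split=> [_ [p -> <-]|_ ->].
    exact: trace0.
  by exists 0 => //; exact: trace0.
have AS n : A n.+1 = traceV N sigma n%:Z by rewrite /A intS_sub1.
have Adim n : exists d, has_dim (A n) d by exact: (traceV_has_dim hN hsigma).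
have Amono n : A n `<=` A n.+1 by rewrite AS; exact: (traceV_mono hN hsigma).
have Adense u e : 0 < e -> exists n v, A n v /\ complex.Re (L2ip (u - v) (u - v)) < e.
  exact: (traceV_dense hN hsigma).
have WE m : traceW N sigma m%:Z = increment (@L2ip _ _ _ sigma) A m.
  by rewrite /increment AS.
split.
- split.
  + move=> m; rewrite WE; split; first exact: (increment_subspace ipL Adim).
    move=> u_ u Wu uu; have [d Wd] := increment_dim ipL Adim m.
    exact: (subspace_closed ipL ipC ip0 ipE Wd Wu).
  + move=> m l ml u w; rewrite !WE; exact: (increments_orth ipC Amono).
  + move=> u; have := orthogonal_expansion ipL ipC ip0 ipE A0 Adim Amono Adense u.
    move=> [w [[Ww wu] wuniq]]; exists w; split; first by split=> // m; rewrite WE.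
    by move=> w' [Ww' w'u]; apply: wuniq; split=> // m; rewrite -WE.
- move=> m; have [dV1 V1d] := Adim m; have [dW Wd] := increment_dim ipL Adim m.
  have cap0 := chain_cap_increment ipL ipE Adim m.
  have dec := increment_decomposition ipL ipC ipE Adim Amono m.
  have Vd := has_dim_direct_sum V1d Wd cap0.
  rewrite -dec AS in Vd; rewrite WE; split.
    split.
    + by split; [exact: (chain_subspace Adim)|exact: (increment_subspace ipL Adim)].
    + by move=> u w Au [_ wo]; exact: (ip_sym0 ipC (wo _ Au)).
    + exact: cap0.
    + by rewrite -AS.
  exists dW, (dV1 + dW)%N, dV1; split=> //.
  by rewrite PoszD addrC addKr.
- move=> m; have [dA Ad] := polyA_has_dim G m%:Z.
  have [dI [dV [kd Vd dE]]] := rank_nullity (trace_lin hN hsigma) Ad.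
  exists dV, dA, dI; split=> //; first by rewrite (traceVE hN hsigma).
    suff -> : vanishing_ideal N `&` polyA G m%:Z =
        polyA G m%:Z `&` [set p | trace hN hsigma p = 0] by [].
    apply/seteqP; split=> p [h1 h2]; split=> //.
      exact/(trace_eq0 hN hmu hsigma h2).
    exact/(trace_eq0 hN hmu hsigma h1).
  by rewrite dE PoszD addrC addKr.
Qed.
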